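(* Let $n\ge1$ and let $\mathbf{V}=(V_1,\ldots,V_n)$ be a commuting $n$-tuple of bounded operators on a Hilbert space $\mathcal H$. Then the following assertions are equivalent. (1) $\mathbf{V}$ is a $\mathbf{\Theta}_n$-isometry. (2) $V_n$ is a contraction and $(V_1,\ldots,V_{n-1},V_n^p)$ is a $\Gamma_n$-isometry.
   Context: Fix integers $m,p\ge 1$ with $p\mid m$ and put $q=m/p$. $\mathbb T$ is the unit circle in $\mathbb C$ and $\mathbb D$ the open unit disc. For $z=(z_1,\ldots,z_n)\in\mathbb C^n$ let $s_i(z)=\sum_{1\le k_1<\cdots<k_i\le n}z_{k_1}\cdots z_{k_i}$ ($1\le i\le n$), $\mathbf s=(s_1,\ldots,s_n)$ and $\Gamma_n=\mathbf s(\overline{\mathbb D}^{\,n})$. Define $\theta=(\theta_1,\ldots,\theta_n)$ by $\theta_i(z)=s_i(z_1^m,\ldots,z_n^m)$ for $1\le i\le n-1$ and $\theta_n(z)=(z_1\cdots z_n)^q$; put $\mathbf{\Theta}_n=\theta(\mathbb D^n)$. The distinguished (Shilov) boundaries are $b\mathbf{\Theta}_n=\theta(\mathbb T^n)$ and $b\Gamma_n=\mathbf s(\mathbb T^n)$. A $\mathbf{\Theta}_n$-unitary (respectively, $\Gamma_n$-unitary) is a commuting $n$-tuple of bounded normal operators whose joint spectrum is contained in $b\mathbf{\Theta}_n$ (respectively, $b\Gamma_n$). A $\mathbf{\Theta}_n$-isometry (respectively, $\Gamma_n$-isometry) on $\mathcal H$ is a commuting $n$-tuple $(V_1,\ldots,V_n)$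 for which there are a Hilbert space $\mathcal K\supseteq\mathcal H$ and a $\mathbf{\Theta}_n$-unitary (respectively, $\Gamma_n$-unitary) $(N_1,\ldots,N_n)$ on $\mathcal K$ with $V_i=N_i|_{\mathcal H}$ for $1\le i\le n$. *)

(* Defs.v *)
From HB Require Import structures.
From mathcomp Require Import all_boot all_order all_algebra.
From mathcomp Require Import complex.
From mathcomp Require Import all_classical all_reals all_analysis.

Set Implicit Arguments.
Unset Strict Implicit.
Unset Printing Implicit Defensive.

Import Order.TTheory GRing.Theory Num.Theory.
Import numFieldNormedType.Exports.

Local Open Scope classical_set_scope.
Local Open Scope ring_scope.
Local Open Scope complex_scope.

(* [inner] is linear in its first argument and conjugate linear in the second.
   The norm of a normed module over [R[i]] is itself [R[i]]-valued. *)
HB.mixin Record CompleteNormedModule_isHilbert (R : realType) H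
    of CompleteNormedModule R[i] H := {
  inner : {dot H for @Num.conj R[i]};
  sqr_norm_inner : forall x : H, `|x| ^+ 2 = inner x x }.

#[short(type="hilbertType")]
HB.structure Definition Hilbert (R : realType) :=
  { H of CompleteNormedModule_isHilbert R H & CompleteNormedModule R[i] H }.

Section Operators.
Context {R : realType}.
Local Notation C := R[i].

Section OneSpace.
Context {H : hilbertType R}.
Implicit Types T S : H -> H.

Definition bounded_operator T : Prop :=
  linear T /\ exists M : C, forall x, `|T x| <= M * `|x|.

Definition contraction_operator T : Prop := forall x, `|T x| <= `|x|.

Definition is_adjoint T S : Prop :=
  bounded_operator S /\ forall x y, inner (T x) y = inner x (S y).

(* Every bounded operator has exactly one adjoint, so [exists2] is harmless. *)
Definition normal_operator T : Prop :=
  bounded_operator T /\ exists2 S, is_adjoint T S & T \o S =1 S \o T.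

Definition commuting_tuple n (T : 'I_n -> H -> H) : Prop :=
  forall i j, T i \o T j =1 T j \o T i.

(* The Koszul complex of a commuting tuple [T].  An element of the exterior
   algebra of [C^n] tensored with [H] is given by its coefficients on the
   basis vectors [e_A], and the differential sends [e_A (x) x] to
   [\sum_i (e_i /\ e_A) (x) T i x].  The sign is that of the reordering of
   [e_i /\ e_(A :\ i)]. *)
Definition koszul n (T : 'I_n -> H -> H) (f : {ffun {set 'I_n} -> H}) :
    {ffun {set 'I_n} -> H} :=
  [ffun A : {set 'I_n} =>
    \sum_(i in A) (-1) ^+ #|[set j in A | (j < i)%N]| *: T i (f (A :\ i))].

(* The differential is homogeneous of degree one, hence exactness of the total
   complex is exactness in every degree. *)
Definition koszul_exact n (T : 'I_n -> H -> H) : Prop :=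
  forall f, koszul T f = 0 -> exists g, f = koszul T g.

(* The Taylor joint spectrum. *)
Definition joint_spectrum n (T : 'I_n -> H -> H) : set ('I_n -> C) :=
  [set l | ~ koszul_exact (fun i x => T i x - l i *: x)].

Definition unitary_tuple n (X : set ('I_n -> C)) (N : 'I_n -> H -> H) : Prop :=
  [/\ commuting_tuple N, forall i, normal_operator (N i)
    & joint_spectrum N `<=` X].

End OneSpace.

(* [J] realizes [H] as a (necessarily closed) subspace of [K]. *)
Definition isometry_tuple (H : hilbertType R) n (X : set ('I_n -> C))
    (V : 'I_n -> H -> H) : Prop :=
  [/\ commuting_tuple V, forall i, bounded_operator (V i) &
    exists (K : hilbertType R) (J : {linear H -> K}) (N : 'I_n -> K -> K),
      [/\ forall x y, inner (J x) (J y) = inner x y,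
          unitary_tuple X N
        & forall i x, J (V i x) = N i (J x)]].

Definition elem_sym n (k : nat) (z : 'I_n -> C) : C :=
  \sum_(A : {set 'I_n} | #|A| == k) \prod_(j in A) z j.

(* Components are indexed from [0]: component [i] is the usual [s_(i+1)]. *)
Definition sym_map n (z : 'I_n -> C) : 'I_n -> C :=
  fun i => elem_sym i.+1 z.

Definition theta_map (m p n : nat) (z : 'I_n.+1 -> C) : 'I_n.+1 -> C :=
  fun i => if i == ord_max then (\prod_j z j) ^+ (m %/ p)
           else elem_sym i.+1 (fun j => z j ^+ m).

Definition torus n : set ('I_n -> C) := [set z | forall i, `|z i| = 1].

Definition bGamma n : set ('I_n -> C) := @sym_map n @` @torus n.

Definition bTheta (m p n : nat) : set ('I_n.+1 -> C) :=
  @theta_map m p n @` @torus n.+1.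

Definition Gamma_isometry (H : hilbertType R) n (V : 'I_n -> H -> H) : Prop :=
  isometry_tuple (@bGamma n) V.

Definition Theta_isometry (m p : nat) (H : hilbertType R) n
    (V : 'I_n.+1 -> H -> H) : Prop :=
  isometry_tuple (@bTheta m p n) V.

End Operators.

(* Main.v *)
(** The joint spectrum of a doubly commuting normal tuple [N] is its joint
    approximate point spectrum: if the Koszul complex is exact, the uniform
    boundedness principle bounds [\sum_i `|(N i - l i) x|] from below; conversely
    such a bound makes [\sum_i (N i - l i)^* (N i - l i)] invertible, which yields a
    contracting homotopy. Commuting normal operators commute doubly by Fuglede's
    theorem, for which the Liouville argument is run with [(1 + a S)^k B (1 - a S)^k],
    [S = T^*], a polynomial in [a], in place of exponentials.
    Joint approximate eigenvectors are produced one operator at a time, by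
    maximizing [`|N x|] on approximate null spaces; this gives the spectral mapping
    [N_n |-> N_n ^ p] and shows that [N_n] is isometric when its spectrum lies on
    the circle.

    For (2) => (1), let [M] be a Gamma-unitary extension of [(V', V_n ^ p)]. Then
    [V_n] is an isometry commuting with [V'], and [M^{*a} J h |-> M^{*a} J V_n h]
    extends it to a unitary [U] with [U ^ p = M_n] on the reducing subspace
    generated by [H]. A point of the joint spectrum of [(M', U)] is mapped into the
    boundary of Gamma by taking the [p]-th power of its last entry, hence lies in
    the boundary of Theta, after correcting [m]-th roots by an [m]-th root of
    unity. *)

Require Import Defs.
From HB Require Import structures.
From mathcomp Require Import all_boot all_order all_algebra cyclic separable cyclotomic.
From mathcomp Require Import complex.
From mathcomp Require Import all_classical all_reals all_analysis.
From mathcomp Require Import ring lra zify.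

Set Implicit Arguments.
Unset Strict Implicit.
Unset Printing Implicit Defensive.

Import Order.TTheory GRing.Theory Num.Theory.
Import numFieldNormedType.Exports.

Local Open Scope classical_set_scope.
Local Open Scope ring_scope.
Local Open Scope complex_scope.

(** * Real-valued norms and inner products *)

Section RealNorm.
Context {R : realType}.
Local Notation C := R[i].

(** Norms take values in [R[i]]. Their real parts live in an ordered field where [lra] and [nra]
    apply, and [nrmE] shows that nothing is lost. *)
Definition nrm {V : normedZmodType C} (x : V) : R := complex.Re `|x|.

Section Generic.
Context {V : normedZmodType C}.
Implicit Types x y : V.

Lemma nrmE x : `|x| = (nrm x)%:C.
Proof. by rewrite /nrm RRe_real // ger0_real. Qed.

Lemma nrm_ge0 x : 0 <= nrm x.
Proof. by rewrite -ler0c -nrmE. Qed.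

Lemma nrm0 : nrm (0 : V) = 0.
Proof. by rewrite /nrm normr0. Qed.

Lemma nrm_eq0 x : nrm x = 0 -> x = 0.
Proof. by move=> h; apply/eqP; rewrite -normr_eq0 nrmE h. Qed.

Lemma nrm_gt0 x : x != 0 -> 0 < nrm x.
Proof. by move=> h; rewrite -ltcR -nrmE normr_gt0. Qed.

Lemma nrmN x : nrm (- x) = nrm x.
Proof. by rewrite /nrm normrN. Qed.

Lemma nrmB x y : nrm (x - y) = nrm (y - x).
Proof. by rewrite /nrm distrC. Qed.

Lemma nrmD x y : nrm (x + y) <= nrm x + nrm y.
Proof. by rewrite -lecR rmorphD /= -!nrmE ler_normD. Qed.

Lemma nrm_sum (I : Type) (s : seq I) (P : pred I) (F : I -> V) :
  nrm (\sum_(i <- s | P i) F i) <= \sum_(i <- s | P i) nrm (F i).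
Proof.
elim/big_rec2: _ => [|i a b _ h]; first by rewrite nrm0.
by rewrite (le_trans (nrmD _ _)) // lerD2l.
Qed.

End Generic.

Lemma nrmZ {V : normedModType C} (a : C) (x : V) : nrm (a *: x) = nrm a * nrm x.
Proof. by apply: complexI; rewrite rmorphM /= -!nrmE normrZ. Qed.

Lemma nrmM (a b : C) : nrm (a * b) = nrm a * nrm b.
Proof. by apply: complexI; rewrite rmorphM /= -!nrmE normrM. Qed.

Lemma nrmX (a : C) k : nrm (a ^+ k) = nrm a ^+ k.
Proof. by apply: complexI; rewrite rmorphXn /= -!nrmE normrX. Qed.

Lemma nrm_real (r : R) : nrm (r%:C) = `|r|.
Proof. by rewrite /nrm normc_def /= expr0n addr0 sqrtr_sqr. Qed.

Lemma nrm_conj (a : C) : nrm a^* = nrm a.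
Proof. by rewrite /nrm normcJ. Qed.

Lemma nrm1 : nrm (1 : C) = 1.
Proof. by rewrite /nrm normr1. Qed.

Lemma nrm_i : nrm ('i : C) = 1.
Proof. by rewrite /nrm normc_def /= expr0n expr1n add0r sqrtr1. Qed.

Lemma ge0_le_eps (a : R) (C0 : R) : (forall e, 0 < e -> a <= C0 * e) -> a <= 0.
Proof.
move=> h; case: (leP a 0) => // a0.
have c0 : 0 <= `|C0| by [].
have := h (a / (2 * (`|C0| + 1))) ltac:(apply: divr_gt0 => //; lra).
rewrite leNgt => /negP[]; rewrite mulrCA.
rewrite gtr_pMr // ltr_pdivrMr; last lra.
have := ler_norm C0; lra.
Qed.

End RealNorm.

Section Inner.
Context {R : realType} {H : hilbertType R}.
Local Notation C := R[i].
Implicit Types x y z : H.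

(** The underlying real inner product. It reduces adjoint identities and estimates to real
    arithmetic; [inner_rip] recovers the complex one. *)
Definition rip x y : R := complex.Re (inner x y).

Lemma innerC x y : inner x y = (inner y x)^*.
Proof. by have := hermC (@inner R H) x y; rewrite expr0 mul1r. Qed.

Lemma innerDl x y z : inner (x + y) z = inner x z + inner y z.
Proof. exact: linearDl. Qed.

Lemma innerZl a x z : inner (a *: x) z = a * inner x z.
Proof. exact: linearZl_LR. Qed.

Lemma innerNl x z : inner (- x) z = - inner x z.
Proof. by rewrite -scaleN1r innerZl mulN1r. Qed.

Lemma ripC x y : rip x y = rip y x.
Proof. by rewrite /rip innerC; case: (inner y x). Qed.

Lemma ripDl x y z : rip (x + y) z = rip x z + rip y z.
Proof. by rewrite /rip innerDl; case: (inner x z) (inner y z) => [? ?] []. Qed.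

Lemma ripDr x y z : rip z (x + y) = rip z x + rip z y.
Proof. by rewrite !(ripC z) ripDl. Qed.

Lemma ripZl (r : R) x z : rip (r%:C *: x) z = r * rip x z.
Proof.
by rewrite /rip innerZl; case: (inner x z) => a b /=; rewrite mul0r subr0.
Qed.

Lemma ripZr (r : R) x z : rip z (r%:C *: x) = r * rip z x.
Proof. by rewrite !(ripC z) ripZl. Qed.

Lemma ripNl x z : rip (- x) z = - rip x z.
Proof. by have := ripZl (-1) x z; rewrite rmorphN1 scaleN1r mulN1r. Qed.

Lemma innerZr a x z : inner x (a *: z) = a^* * inner x z.
Proof. by rewrite innerC innerZl rmorphM /= -innerC. Qed.

Lemma rip_adjZ a x y : rip (a *: x) y = rip x (a^* *: y).
Proof.
rewrite /rip innerZl innerZr; congr (complex.Re (_ * _)).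
exact: esym (conjcK a).
Qed.

Lemma sqr_nrm x : nrm x ^+ 2 = rip x x.
Proof. by rewrite /rip -sqr_norm_inner nrmE -rmorphXn. Qed.

Lemma sqr_nrmD x y : nrm (x + y) ^+ 2 = nrm x ^+ 2 + 2 * rip x y + nrm y ^+ 2.
Proof. by rewrite !sqr_nrm ripDl !ripDr (ripC y x); ring. Qed.

Lemma sqr_nrmB x y : nrm (x - y) ^+ 2 = nrm x ^+ 2 - 2 * rip x y + nrm y ^+ 2.
Proof. by rewrite sqr_nrmD nrmN ripC ripNl ripC mulrN. Qed.

Lemma rip_le x y : rip x y <= nrm x * nrm y.
Proof.
have h : nrm (x + y) ^+ 2 <= (nrm x + nrm y) ^+ 2.
  by rewrite lerXn2r ?nnegrE ?nrm_ge0 ?addr_ge0 ?nrm_ge0 // nrmD.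
by move: h; rewrite sqr_nrmD; nra.
Qed.

Lemma rip_ext x y : (forall z, rip x z = rip y z) -> x = y.
Proof.
move=> h; apply/eqP; rewrite -subr_eq0; apply/eqP/nrm_eq0/eqP.
by rewrite -sqrf_eq0 sqr_nrm ripDl ripNl h subrr.
Qed.

Lemma inner_ext x y : (forall z, inner x z = inner y z) -> x = y.
Proof. by move=> h; apply: rip_ext => z; rewrite /rip h. Qed.

Definition innerE := (innerDl, innerZl, innerNl).

(** Polarization: a real inner product is determined by the norms of x, y and x + y. *)
Lemma isometric_rip (f : H -> H) : (forall x, nrm (f x) = nrm x) ->
  linear f -> forall x y, rip (f x) (f y) = rip x y.
Proof.
move=> nf lf x y; have := sqr_nrmD (f x) (f y).
rewrite -[f x]scale1r -lf !scale1r !nf sqr_nrmD => h; lra.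
Qed.

Lemma inner_rip x y : inner x y = rip x y +i* rip x ('i *: y).
Proof.
rewrite /rip innerZr; case: (inner x y) => a b /=.
by congr (_ +i* _); ring.
Qed.

End Inner.

Section LinearProp.
Context {R : realType} {U V : lmodType R[i]} {T : U -> V} (lT : linear T).

Lemma linP_D x y : T (x + y) = T x + T y.
Proof. by rewrite -[x]scale1r lT !scale1r. Qed.

Lemma linP_0 : T 0 = 0.
Proof. by apply: (addrI (T 0)); rewrite -linP_D !addr0. Qed.

Lemma linP_Z a x : T (a *: x) = a *: T x.
Proof. by rewrite -[a *: x]addr0 lT linP_0 addr0. Qed.

Lemma linP_N x : T (- x) = - T x.
Proof. by rewrite -scaleN1r linP_Z scaleN1r. Qed.

Lemma linP_B x y : T (x - y) = T x - T y.
Proof. by rewrite linP_D linP_N. Qed.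

Lemma linP_sum (I : Type) (s : seq I) (P : pred I) (F : I -> U) :
  T (\sum_(i <- s | P i) F i) = \sum_(i <- s | P i) T (F i).
Proof. exact: (big_morph T linP_D linP_0). Qed.

End LinearProp.

(** * Bounded operators and adjoints *)

Section Bounded.
Context {R : realType} {H : hilbertType R}.
Local Notation C := R[i].
Implicit Types T S : H -> H.

Lemma bounded_lin T : bounded_operator T -> linear T.
Proof. by case. Qed.

Lemma bounded_nrm T : bounded_operator T ->
  exists2 M : R, 0 < M & forall x, nrm (T x) <= M * nrm x.
Proof.
case=> lT [M hM]; exists (nrm M + 1) => [|x].
  by rewrite ltr_wpDl ?nrm_ge0.
apply: (@le_trans _ _ (nrm M * nrm x)); last first.
  by rewrite ler_wpM2r ?nrm_ge0 // lerDl.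
have h0 : 0 <= M * `|x| by rewrite (le_trans _ (hM x)).
by rewrite -nrmZ -lecR -!nrmE normrZ -[`|x|]normr_id -normrM ger0_norm.
Qed.

Lemma nrm_bounded T (M : R) : linear T -> (forall x, nrm (T x) <= M * nrm x) ->
  bounded_operator T.
Proof.
move=> lT hM; split=> //; exists M%:C => x.
by rewrite !nrmE -rmorphM /= lecR.
Qed.

End Bounded.

Section OperatorAlgebra.
Context {R : realType} {H : hilbertType R}.
Local Notation C := R[i].
Implicit Types T S : H -> H.

Lemma bounded_id : bounded_operator (@id H).
Proof. by apply: (@nrm_bounded _ _ _ 1) => // x; rewrite mul1r. Qed.

Lemma bounded_comp T S : bounded_operator T -> bounded_operator S ->
  bounded_operator (T \o S).
Proof.
move=> bT bS; have [M M0 hM] := bounded_nrm bT; have [L L0 hL] := bounded_nrm bS.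
apply: (@nrm_bounded _ _ _ (M * L)) => [a x y /=|x /=].
  by rewrite (bounded_lin bS) (bounded_lin bT).
by rewrite -mulrA (le_trans (hM _)) // ler_wpM2l ?hL ?ltW.
Qed.

Lemma bounded_iter T k : bounded_operator T -> bounded_operator (iter k T).
Proof.
move=> bT; elim: k => [|k ih]; first exact: bounded_id.
exact: (bounded_comp bT ih).
Qed.

Lemma bounded_scale a T : bounded_operator T ->
  bounded_operator (fun x => a *: T x).
Proof.
move=> bT; have [M M0 hM] := bounded_nrm bT.
apply: (@nrm_bounded _ _ _ (nrm a * M)) => [b x y|x].
  by rewrite (bounded_lin bT) scalerDr !scalerA mulrC.
by rewrite nrmZ -mulrA ler_wpM2l ?hM ?nrm_ge0.
Qed.

Lemma bounded_add T S : bounded_operator T -> bounded_operator S ->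
  bounded_operator (fun x => T x + S x).
Proof.
move=> bT bS; have [M M0 hM] := bounded_nrm bT; have [L L0 hL] := bounded_nrm bS.
apply: (@nrm_bounded _ _ _ (M + L)) => [a x y|x].
  by rewrite (bounded_lin bS) (bounded_lin bT) scalerDr addrACA.
by rewrite (le_trans (nrmD _ _)) // mulrDl lerD ?hM ?hL.
Qed.

Lemma bounded_shift a T : bounded_operator T ->
  bounded_operator (fun x => T x - a *: x).
Proof.
move=> bT; rewrite (_ : (fun x => _) = fun x => T x + (- a) *: x).
  exact: bounded_add bT (bounded_scale (- a) bounded_id).
by apply/funext => x; rewrite scaleNr.
Qed.

Lemma bounded_sum (I : Type) (s : seq I) (F : I -> H -> H) :
  (forall i, bounded_operator (F i)) ->
  bounded_operator (fun x => \sum_(i <- s) F i x).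
Proof.
move=> bF; elim: s => [|i s ih].
  apply: (@nrm_bounded _ _ _ 0) => [a x y|x]; rewrite !big_nil ?nrm0 ?mul0r //.
  by rewrite scaler0 addr0.
rewrite (_ : (fun x => _) = fun x => F i x + \sum_(j <- s) F j x).
  exact: bounded_add.
by apply/funext => x; rewrite big_cons.
Qed.

(** The adjoint relation in real form, separated from boundedness; [adj_is_adjoint] upgrades it to
    the complex notion. *)
Definition adj T S := forall x y, rip (T x) y = rip x (S y).

Lemma adj_sym T S : adj T S -> adj S T.
Proof. by move=> h x y; rewrite ripC -h ripC. Qed.

Lemma is_adjoint_adj T S : is_adjoint T S -> adj T S.
Proof. by case=> _ h x y; rewrite /rip h. Qed.

Lemma adj_is_adjoint T S : linear T -> bounded_operator S -> adj T S ->
  is_adjoint T S.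
Proof.
move=> lT bS h; split=> // x y; rewrite !inner_rip h; congr (_ +i* _).
by rewrite h (linP_Z (bounded_lin bS)).
Qed.

Lemma adj_iter T S k : adj T S -> adj (iter k T) (iter k S).
Proof.
move=> h; elim: k => [//|k ih] x y; rewrite iterS h ih.
by rewrite -iterSr.
Qed.

Lemma adj_shift a T S : adj T S ->
  adj (fun x => T x - a *: x) (fun x => S x - a^* *: x).
Proof.
move=> h x y; rewrite -!scaleNr ripDl ripDr h; congr (_ + _).
by rewrite rip_adjZ; congr (rip _ (_ *: _)); rewrite -rmorphN.
Qed.

Lemma adj_commute T S A B : adj T S -> adj A B -> T \o A =1 A \o T ->
  S \o B =1 B \o S.
Proof.
move=> h h' c x; apply: rip_ext => z /=.
by rewrite !(ripC _ z) -h -h' -h' -h; have /= -> := c z.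
Qed.

Lemma normal_nrm T S x : adj T S -> T \o S =1 S \o T -> nrm (S x) = nrm (T x).
Proof.
move=> h c; apply/eqP; rewrite -(@eqrXn2 _ 2) ?nrm_ge0 // !sqr_nrm; apply/eqP.
by rewrite (adj_sym h) h; have /= -> := c x.
Qed.

End OperatorAlgebra.

(** * Geometric convergence *)

Section Completeness.
Context {R : realType} {V : completeNormedModType R[i]}.

(** The explicit rate is what matters: it serves the gliding hump, the inversion of coercive
    operators and the closure of graphs. *)
Lemma geometric_limit (x : nat -> V) (D q : R) : 0 <= q -> q < 1 ->
  (forall k, nrm (x k.+1 - x k) <= D * q ^+ k) ->
  exists l, forall k, nrm (l - x k) <= D / (1 - q) * q ^+ k.
Proof.
move=> q0 q1 hx.
have D0 : 0 <= D by have := hx 0%N; rewrite expr0 mulr1; apply: le_trans; exact: nrm_ge0.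
have r0 : 0 < 1 - q by lra.
(* Keeping the exact geometric sum, rather than its bound, lets the induction on m close. *)
have hkm k m : nrm (x (k + m)%N - x k) <= D / (1 - q) * (q ^+ k - q ^+ (k + m)).
  elim: m => [|m ih]; first by rewrite addn0 !subrr nrm0 mulr0.
  rewrite addnS -(subrKA (x (k + m)%N)) (le_trans (nrmD _ _)) //.
  rewrite (le_trans (lerD (hx _) ih)) //.
  rewrite [leLHS](_ : _ = D / (1 - q) * ((1 - q) * q ^+ (k + m) + (q ^+ k - q ^+ (k + m)))).
    by rewrite exprS; apply: ler_wpM2l; [exact: divr_ge0 D0 (ltW r0)|lra].
  by field; rewrite gt_eqF.
have hle k j : (k <= j)%N -> nrm (x j - x k) <= D / (1 - q) * q ^+ k.
  move=> /subnKC <-; rewrite (le_trans (hkm _ _)) // ler_wpM2l //.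
    exact: divr_ge0 D0 (ltW r0).
  by rewrite gerBl exprn_ge0.
have q_cvg : (fun k => D / (1 - q) * q ^+ k) @ \oo --> (0 : R).
  rewrite -(mulr0 (D / (1 - q))); apply: cvgMr.
  by apply: cvg_expr; rewrite ger0_norm.
have cx : cvg (x @ \oo).
  apply: cauchy_cvg; apply: cauchy_exP => e e0.
  have [e1 -> e10] : exists2 e1 : R, e = e1%:C & 0 < e1.
    move: e0; rewrite ltcE /= => /andP[/eqP i0 r]; exists (complex.Re e) => //.
    by case: e i0 r => a b /= ->.
  have /cvgrPdist_lt/(_ _ e10)[N _ hN] := q_cvg.
  exists (x N); exists N => // n /= nN.
  rewrite -ball_normE /= nrmE ltcR nrmB (le_lt_trans (hle _ _ nN)) //.
  have := hN N (leqnn _); rewrite sub0r normrN => h.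
  exact: (le_lt_trans (ler_norm _)).
exists (lim (x @ \oo)) => k; rewrite -subr_le0.
apply: (@ge0_le_eps _ _ 1) => e e0; rewrite mul1r.
have e0' : 0 < e%:C by rewrite ltcR.
have /cvgrPdist_lt/(_ _ e0')[N _ hN] := cx.
have := hN (maxn N k) (leq_maxl _ _); rewrite nrmE ltcR => h1.
have := hle k (maxn N k) (leq_maxr _ _) => h2.
rewrite -(subrKA (x (maxn N k))).
have := nrmD (lim (x @ \oo) - x (maxn N k)) (x (maxn N k) - x k); lra.
Qed.

End Completeness.

(** * Fuglede's theorem *)

Section VectorPolynomial.
Context {R : realType} {V : normedModType R[i]}.
Local Notation C := R[i].

(** The polynomial X^k - 1 splits and is separable, so it has k distinct roots, among which one is
    primitive. *)
Lemma prim_root_exists k : (0 < k)%N -> exists w : C, k.-primitive_root w.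
Proof.
pose p : {poly C} := 'X^k - 1; have [r Dp] := closed_field_poly_normal p.
move=> k_gt0; rewrite (monicP _) ?monicXnsubC // scale1r in Dp.
have rn1 : all k.-unity_root r by apply/allP=> z; rewrite -root_prod_XsubC -Dp.
have sz_r : (k < (size r).+1)%N.
  by rewrite -(size_prod_XsubC r id) -Dp size_XnsubC.
have [|z] := hasP (has_prim_root k_gt0 rn1 _ sz_r); last by exists z.
by rewrite -separable_prod_XsubC -Dp separable_Xn_sub_1 // pnatr_eq0 -lt0n.
Qed.

Lemma nrm_unity_root (w : C) k : (0 < k)%N -> w ^+ k = 1 -> nrm w = 1.
Proof.
move=> k0 wk; apply/eqP; rewrite -(@pexpr_eq1 _ _ k) ?nrm_ge0 //.
by rewrite -nrmX wk nrm1.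
Qed.

Lemma sum_unity_root (w : C) k : w ^+ k = 1 -> w != 1 ->
  \sum_(j < k) w ^+ j = 0.
Proof.
move=> wk w1; have := subrX1 w k; rewrite wk subrr => /esym/eqP.
by rewrite mulf_eq0 subr_eq0 (negbTE w1) => /eqP.
Qed.

(** A discrete Cauchy formula: averaging over the (d+1)-th roots of unity isolates the coefficient
    of degree one, without any integral. *)
Lemma cauchy_estimate d (c : nat -> V) (r K : R) : (1 < d)%N -> 0 <= r ->
  (forall a : C, nrm a = r -> nrm (\sum_(l < d) a ^+ l *: c l) <= K) ->
  r * nrm (c 1%N) <= K.
Proof.
move=> d1 r0 hK; have [w pw] := @prim_root_exists d.+1 isT.
have w1 := prim_expr_order pw.
have nw : nrm w = 1 by exact: (nrm_unity_root _ w1).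
(* Since w^d is the inverse of w, the term of degree l carries the weight w^(j (l - 1)), whose sum
   over j vanishes unless l = 1. *)
have key : \sum_(j < d.+1) w ^+ (d * j) *: (\sum_(l < d) (r%:C * w ^+ j) ^+ l *: c l)
    = d.+1%:R *: (r%:C *: c 1%N).
  under eq_bigr do rewrite scaler_sumr.
  rewrite exchange_big /= (bigD1 (Ordinal d1)) //= [X in _ + X]big1 ?addr0.
    under eq_bigr => j _.
      rewrite scalerA expr1 mulrCA -exprD -mulSnr exprM w1 expr1n mulr1.
    over.
    by rewrite sumr_const card_ord scaler_nat.
  move=> l l1; under eq_bigr => j _.
    rewrite scalerA exprMn mulrCA -exprM -exprD (mulnC j) -mulnDl exprM.
  over.
  rewrite -scaler_suml -mulr_sumr sum_unity_root ?mulr0 ?scale0r //.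
    by rewrite -exprM mulnC exprM w1 expr1n.
  rewrite -(expr0 w) (eq_prim_root_expr pw) /= mod0n; apply: contra l1 => /eqP h.
  (* As l < d, the only multiple of d + 1 that d + l can equal is d + 1 itself, which forces l =
     1. *)
  have /dvdnP[q] : (d.+1 %| d + l)%N by apply/eqP.
  have ld := ltn_ord l; rewrite -val_eqE /=.
  case: q => [|[|q]]; first lia; first lia.
  by rewrite !mulSn => h2; move: ld d1 h2; lia.
have: nrm (\sum_(j < d.+1) w ^+ (d * j) *: (\sum_(l < d) (r%:C * w ^+ j) ^+ l *: c l))
    <= \sum_(j < d.+1) K.
  rewrite (le_trans (nrm_sum _ _ _)) //; apply: ler_sum => j _.
  rewrite nrmZ nrmX nw expr1n mul1r; apply: hK.
  by rewrite nrmM nrm_real nrmX nw expr1n mulr1 ger0_norm.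
rewrite key !nrmZ nrm_real (ger0_norm r0) sumr_const card_ord -[K *+ _]mulr_natl.
have -> : nrm (d.+1%:R : C) = d.+1%:R by rewrite -(rmorph_nat (real_complex R)) nrm_real ger0_norm.
by rewrite ler_pM2l.
Qed.

(** Only the two lowest coefficients are exposed, as the estimate concerns the first-order one.
    Extending [c] by zero beyond [d] lets the degree grow in [vpoly_mul]. *)
Definition vpoly (f : C -> V) (c0 c1 : V) := exists d (c : nat -> V),
  [/\ (1 < d)%N, forall l, (d <= l)%N -> c l = 0,
      forall a, f a = \sum_(l < d) a ^+ l *: c l, c 0%N = c0 & c 1%N = c1].

Lemma vpoly_cst x : vpoly (fun _ => x) x 0.
Proof.
exists 2, (fun l => if l is 0%N then x else 0); split=> // [[|[]]//|a].
by rewrite !big_ord_recl big_ord0 /= scaler0 !addr0 expr0 scale1r.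
Qed.

Lemma vpoly_lin f c0 c1 (T : V -> V) : linear T -> vpoly f c0 c1 ->
  vpoly (T \o f) (T c0) (T c1).
Proof.
move=> lT [d [c [d1 hd hf <- <-]]]; exists d, (T \o c); split=> // [l dl|a] /=.
  by rewrite hd // (linP_0 lT).
by rewrite hf (linP_sum lT); apply: eq_bigr => l _; rewrite (linP_Z lT).
Qed.

Lemma vpoly_mul f c0 c1 (T : V -> V) : linear T -> vpoly f c0 c1 ->
  vpoly (fun a => f a + a *: T (f a)) c0 (c1 + T c0).
Proof.
move=> lT [d [c [d1 hd hf <- <-]]].
exists d.+1, (fun l => c l + if l is l'.+1 then T (c l') else 0).
split=> [|[|l]//= dl|a||//]; first by rewrite ltnW.
- by rewrite !hd ?(linP_0 lT) ?addr0 //; lia.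
- under eq_bigr do rewrite scalerDr.
  rewrite big_split /= big_ord_recr /= hd // scaler0 addr0 -hf; congr (_ + _).
  rewrite big_ord_recl /= scaler0 add0r {1}hf (linP_sum lT) scaler_sumr.
  by apply: eq_bigr => l _; rewrite (linP_Z lT) scalerA -exprS.
- by rewrite addr0.
Qed.

Lemma vpoly_estimate f c0 c1 (r K : R) : vpoly f c0 c1 -> 0 <= r ->
  (forall a, nrm a = r -> nrm (f a) <= K) -> r * nrm c1 <= K.
Proof.
move=> [d [c [d1 _ hf _ <-]]] r0 h; apply: (cauchy_estimate d1 r0) => a ar.
by rewrite -hf h.
Qed.

End VectorPolynomial.

Section Fuglede.
Context {R : realType} {H : hilbertType R}.
Local Notation C := R[i].
Variables (T S B : H -> H).
Hypotheses (bT : bounded_operator T) (bS : bounded_operator S)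
  (bB : bounded_operator B) (aTS : adj T S) (cTS : T \o S =1 S \o T)
  (cTB : T \o B =1 B \o T).

(** First-order factors of the exponentials of a S and of - conj(a) T; their product approximates
    the exponential of a skew-adjoint operator, which is unitary. *)
Let F (a : C) x := x + a *: S x.
Let P (a : C) x := x - a^* *: T x.

Let iter_comm (f g : H -> H) k x : (forall y, f (g y) = g (f y)) ->
  iter k f (g x) = g (iter k f x).
Proof. by move=> h; elim: k => //= k ->. Qed.

Let iter_comp (f g : H -> H) k x : (forall y, f (g y) = g (f y)) ->
  iter k (f \o g) x = iter k f (iter k g x).
Proof.
move=> h; elim: k => //= k ->; congr f.
by rewrite (iter_comm _ (f := f) (g := g)).
Qed.

Let iter_bound (f : H -> H) k (q : R) x : 0 <= q ->
  (forall y, nrm (f y) <= q * nrm y) -> nrm (iter k f x) <= q ^+ k * nrm x.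
Proof.
move=> q0 h; elim: k => [|k ih]; first by rewrite expr0 mul1r.
by rewrite iterS (le_trans (h _)) // exprS -mulrA ler_wpM2l.
Qed.

Let iter_bound_below (f : H -> H) k (q : R) x : 0 <= q ->
  (forall y, q * nrm y <= nrm (f y)) -> q ^+ k * nrm x <= nrm (iter k f x).
Proof.
move=> q0 h; elim: k => [|k ih]; first by rewrite expr0 mul1r.
by rewrite iterS (le_trans _ (h _)) // exprS -mulrA ler_wpM2l.
Qed.

Let bernoulli (u : R) k : 0 <= u <= 1 -> 1 - k%:R * u <= (1 - u) ^+ k.
Proof.
move=> u01; elim: k => [|k ih]; first by rewrite expr0; lra.
have k0 : (0 : R) <= k%:R by [].
have : (1 - u) * (1 - k%:R * u) <= (1 - u) * (1 - u) ^+ k.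
  by rewrite ler_wpM2l //; lra.
rewrite exprS -natr1; nra.
Qed.

Variable M : R.
Hypotheses (M0 : 0 <= M) (hM : forall x, nrm (T x) <= M * nrm x).

Let hMS x : nrm (S x) <= M * nrm x.
Proof. by rewrite (normal_nrm x aTS cTS). Qed.

(* [a S - a^* T] is skew-adjoint, so the product of the two factors is an
   isometry up to second order in [a]. *)
Let PF_bound a x : nrm (P a (F a x)) <= (1 + 3 * (nrm a * M) ^+ 2) * nrm x.
Proof.
set u := (nrm a * M) ^+ 2; have u0 : 0 <= u by rewrite sqr_ge0.
have lT := bounded_lin bT.
pose W := a *: S x - a^* *: T x.
have -> : P a (F a x) = (x + W) - (a^* * a) *: T (S x).
  by rewrite /P /F /W (linP_D lT) (linP_Z lT) scalerDr scalerA opprD !addrA.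
have W0 : rip x W = 0.
  rewrite ripC ripDl ripNl rip_adjZ (adj_sym aTS) (linP_Z lT) ripC.
  by rewrite subrr.
have nW : nrm W <= 2 * (nrm a * M) * nrm x.
  rewrite (le_trans (nrmD _ _)) // nrmN !nrmZ nrm_conj.
  have := ler_wpM2l (nrm_ge0 a) (hMS x); have := ler_wpM2l (nrm_ge0 a) (hM x); lra.
have n1 : nrm (x + W) <= (1 + 2 * u) * nrm x.
  rewrite -(@ler_pXn2r _ 2) ?nnegrE ?nrm_ge0 ?mulr_ge0 ?nrm_ge0 //; last lra.
  rewrite sqr_nrmD W0.
  have : nrm W ^+ 2 <= (2 * (nrm a * M) * nrm x) ^+ 2.
    by rewrite lerXn2r ?nnegrE ?nrm_ge0 ?mulr_ge0 ?nrm_ge0.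
  rewrite (_ : (2 * (nrm a * M) * nrm x) ^+ 2 = 4 * u * nrm x ^+ 2); last by rewrite /u; ring.
  have := sqr_ge0 (nrm x); nra.
have n2 : nrm ((a^* * a) *: T (S x)) <= u * nrm x.
  rewrite nrmZ nrmM nrm_conj.
  have h1 : nrm (T (S x)) <= M * (M * nrm x).
    by rewrite (le_trans (hM _)) // ler_wpM2l.
  have := ler_wpM2l (mulr_ge0 (nrm_ge0 a) (nrm_ge0 a)) h1; rewrite /u; lra.
rewrite (le_trans (nrmD _ _)) // nrmN; lra.
Qed.

(** [P (- a)] inverts [P a] up to second order, since their product is 1 - conj(a)^2 T^2. *)
Let PP_bound a x : (1 - (nrm a * M) ^+ 2) * nrm x <= nrm (P a (P (- a) x)).
Proof.
have lT := bounded_lin bT.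
have -> : P a (P (- a) x) = x - (a^* ^+ 2) *: T (T x).
  rewrite /P rmorphN scaleNr opprK (linP_D lT) (linP_Z lT) scalerDr scalerA.
  by rewrite opprD addrA addrK.
have n2 : nrm ((a^* ^+ 2) *: T (T x)) <= (nrm a * M) ^+ 2 * nrm x.
  rewrite nrmZ nrmX nrm_conj.
  have h1 : nrm (T (T x)) <= M * (M * nrm x).
    by rewrite (le_trans (hM _)) // ler_wpM2l.
  have := ler_wpM2l (sqr_ge0 (nrm a)) h1; lra.
have := nrmD (x - (a^* ^+ 2) *: T (T x)) ((a^* ^+ 2) *: T (T x)).
rewrite subrK; lra.
Qed.

Variable L : R.
Hypotheses (L0 : 0 <= L) (hL : forall x, nrm (B x) <= L * nrm x).

Let f k x a := iter k (F a) (B (iter k (F (- a)) x)).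

(** Each of the k factors on either side of [B] contributes once to the first-order term, so the
    commutator appears k times. *)
Let f_poly k x : vpoly (f k x) (B x) (k%:R *: (S (B x) - B (S x))).
Proof.
have lS := bounded_lin bS; have lB := bounded_lin bB.
have h1 : vpoly (fun a => iter k (F (- a)) x) x (k%:R *: - S x).
  elim: (k) => [|j ih]; first by rewrite scale0r; exact: vpoly_cst.
  have lNS : linear (fun x => - S x) by move=> a y z; rewrite lS opprD scalerN.
  have := vpoly_mul lNS ih; congr vpoly.
    by apply/funext => a /=; rewrite /F scaleNr scalerN.
  by rewrite -natr1 scalerDl scale1r.
have := vpoly_lin lB h1; set g := B \o _; rewrite (_ : f k x = fun a => iter k (F a) (g a)) //.
rewrite (_ : k%:R *: (S (B x) - B (S x)) =
  B (k%:R *: - S x) + k%:R *: S (B x)); last first.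
  by rewrite (linP_Z lB) (linP_N lB) -scalerDr addrC.
move: (B (k%:R *: _)) g {h1} => c1 g hg.
elim: k => [|j ih]; first by rewrite scale0r addr0.
have := vpoly_mul lS ih; congr vpoly.
by rewrite -natr1 scalerDl scale1r addrA.
Qed.

(** [P] commutes with [F] and with [B], so applying P(a)^k P(-a)^k to [f k x a] pairs every [F] with
    a [P]. The result is bounded by [PF_bound], while [PP_bound] shows that little norm was lost.
    The factors are 2 above and 1/2 below, whence 4. *)
Let f_bound k x a : 12 * (k%:R * (nrm a * M) ^+ 2) <= 1 -> (0 < k)%N ->
  nrm (f k x a) <= 4 * (L * nrm x).
Proof.
move=> hu k0; set u := (nrm a * M) ^+ 2 in hu.
have lT := bounded_lin bT; have lS := bounded_lin bS; have lB := bounded_lin bB.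
have u0 : 0 <= u by rewrite sqr_ge0.
have k1 : 1 <= k%:R :> R by rewrite ler1n.
have PC b c y : P b (P c y) = P c (P b y).
  rewrite /P !(linP_B lT) !(linP_Z lT) !scalerBr !scalerA (mulrC (b^*)).
  by rewrite !opprD !addrA; congr (_ + _); exact: addrAC.
have PFC b c y : P b (F c y) = F c (P b y).
  rewrite /P /F (linP_D lT) (linP_Z lT) (linP_B lS) (linP_Z lS) !scalerBr !scalerDr.
  have /= -> := cTS y; rewrite !scalerA (mulrC (c)) opprD.
  by rewrite !addrA; congr (_ + _); exact: addrAC.
have PBC b y : P b (B y) = B (P b y).
  by rewrite /P (linP_B lB) (linP_Z lB); have /= -> := cTB y.
have eq : iter k (P a \o P (- a)) (f k x a) =
    iter k (P a \o F a) (B (iter k (P (- a) \o F (- a)) x)).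
  rewrite !iter_comp //; congr (iter k (P a) _).
  have cPF : iter k (P (- a)) (f k x a) =
     iter k (F a) (iter k (P (- a)) (B (iter k (F (- a)) x))).
    by rewrite /f; elim: {2 4}(k) => //= j <-; rewrite (iter_comm _ _ (f := P (- a))).
  by rewrite cPF; congr iter; rewrite (iter_comm _ _ (f := P (- a)) (g := B)) ?iter_comp.
have a1 : 0 <= 1 - u by nra.
have a2 : 0 <= 1 + 3 * u by lra.
have e1 := iter_bound_below k (f k x a) a1 (PP_bound a).
have e2 := iter_bound k (B (iter k (P (- a) \o F (- a)) x)) a2 (PF_bound a).
have a2' : 0 <= 1 + 3 * (nrm (- a) * M) ^+ 2 by rewrite nrmN.
have e3 := iter_bound k x a2' (PF_bound (- a)).
rewrite nrmN -/u in e3.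
have e4 : 1 / 2 <= (1 - u) ^+ k.
  by apply: le_trans (bernoulli k _); nra.
have [q2 hq q0] : exists2 q : R, (1 + 3 * u) ^+ k * (1 + 3 * u) ^+ k = q & 0 <= q <= 2.
  exists ((1 + 3 * u) ^+ k * (1 + 3 * u) ^+ k) => //.
  (* A lower bound for (1 - 3u)^(2k) gives an upper bound for (1 + 3u)^(2k), because their product
     is at most 1. *)
  have h1 : 1 / 2 <= (1 - 3 * u) ^+ (k + k).
    apply: le_trans (bernoulli _ _); last by nra.
    by rewrite natrD; nra.
  have h2 : (1 + 3 * u) ^+ (k + k) * (1 - 3 * u) ^+ (k + k) <= 1.
    by rewrite -exprMn exprn_ile1 //; nra.
  have h3 : 0 <= (1 + 3 * u) ^+ (k + k) by rewrite exprn_ge0.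
  by rewrite -exprD; apply/andP; split=> //; nra.
rewrite eq in e1.
have p0 : 0 <= (1 + 3 * u) ^+ k by rewrite exprn_ge0.
have e5 : nrm (B (iter k (P (- a) \o F (- a)) x)) <= L * ((1 + 3 * u) ^+ k * nrm x).
  by rewrite (le_trans (hL _)) // ler_wpM2l.
have e6 := ler_wpM2l p0 e5.
have e7 : (1 + 3 * u) ^+ k * (L * ((1 + 3 * u) ^+ k * nrm x)) <= 2 * (L * nrm x).
  rewrite (_ : _ * _ = q2 * (L * nrm x)); last by rewrite -hq; ring.
  by rewrite ler_wpM2r ?mulr_ge0 ?nrm_ge0 //; lra.
have := nrm_ge0 (f k x a); rewrite -/u in e1 e2.
move: e1 e2 e6 e7 e4; set w := (1 - u) ^+ k; set fn := nrm (f k x a).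
move=> *; nra.
Qed.

(** Cauchy's estimate on the circle of radius r/k: the k in the coefficient cancels the one in the
    radius, so r may be arbitrarily large. *)
Let commutator_bound x (r : R) : 0 < r ->
  r * nrm (S (B x) - B (S x)) <= 4 * (L * nrm x).
Proof.
(* For |a| = r/k the condition of [f_bound] reads 12 (r M)^2 <= k. *)
move=> r0; pose k := (Num.truncn (12 * (r * M) ^+ 2)).+1.
have kb : 12 * (r * M) ^+ 2 <= k%:R by rewrite ltW // truncnS_gt.
have k0 : 0 < k%:R :> R by rewrite ltr0n.
have rk : 0 <= r / k%:R by rewrite divr_ge0 // ltW.
have := vpoly_estimate (f_poly k x) rk.
move=> /(_ (4 * (L * nrm x))); rewrite nrmZ.
have -> : nrm (k%:R : C) = k%:R.
  by rewrite -(rmorph_nat (real_complex R)) nrm_real ger0_norm // ltW.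
rewrite [r / _ * _]mulrA divfK ?gt_eqF //; apply => a ar; apply: f_bound => //.
rewrite ar (_ : _ * _ = (12 * (r * M) ^+ 2) / k%:R); last by field; rewrite gt_eqF.
by rewrite ler_pdivrMr // mul1r.
Qed.

Lemma fuglede_of_bounds : S \o B =1 B \o S.
Proof.
move=> x /=; apply/eqP; rewrite -subr_eq0; apply/eqP/nrm_eq0.
apply/le_anti; rewrite nrm_ge0 andbT.
apply: (@ge0_le_eps _ _ (4 * (L * nrm x))) => e e0.
have := @commutator_bound x e^-1; rewrite invr_gt0 => /(_ e0).
by rewrite mulrC ler_pdivrMr.
Qed.

End Fuglede.

Lemma fuglede (R : realType) (H : hilbertType R) (T S B : H -> H) :
  bounded_operator T -> bounded_operator S -> bounded_operator B ->
  adj T S -> T \o S =1 S \o T -> T \o B =1 B \o T -> S \o B =1 B \o S.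
Proof.
move=> bT bS bB a c c'; have [M M0 hM] := bounded_nrm bT.
have [L L0 hL] := bounded_nrm bB.
exact: (fuglede_of_bounds bT bS bB a c c' (ltW M0) hM (ltW L0) hL).
Qed.

(** * Approximate eigenvectors *)

Section ApproximateNull.
Context {R : realType} {H : hilbertType R}.
Local Notation C := R[i].
Implicit Types (T S : H -> H) (phi psi : H -> R).

Definition normal_pair T S := [/\ bounded_operator T, bounded_operator S,
  adj T S & T \o S =1 S \o T].

Lemma normal_pair_shift T S a : normal_pair T S ->
  normal_pair (fun x => T x - a *: x) (fun x => S x - a^* *: x).
Proof.
case=> bT bS h c; split; [exact: bounded_shift|exact: bounded_shift
  |exact: adj_shift|move=> x /=].
rewrite (linP_B (bounded_lin bT)) (linP_B (bounded_lin bS)).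
rewrite (linP_Z (bounded_lin bT)) (linP_Z (bounded_lin bS)).
by have /= -> := c x; apply: inner_ext => z; rewrite !innerE; ring.
Qed.

Definition seminorm phi := [/\ forall x, 0 <= phi x,
  forall x y, phi (x + y) <= phi x + phi y
  & forall a x, phi (a *: x) = nrm a * phi x].

(** A substitute for a nonzero kernel of [phi], which need not exist: unit vectors on which [phi] is
    arbitrarily small. *)
Definition approx_null phi :=
  forall e : R, 0 < e -> exists2 x, x != 0 & phi x <= e * nrm x.

(** The counterpart of invariance under [T] of the kernel of [phi]. *)
Definition stable phi T := exists M : R, forall x, phi (T x) <= M * phi x.

Lemma approx_null_le phi psi : (forall x, psi x <= phi x) ->
  approx_null phi -> approx_null psi.
Proof.
by move=> h a e /a[x x0 hx]; exists x => //; rewrite (le_trans (h x)).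
Qed.

Lemma seminorm_nrm T : linear T -> seminorm (fun x => nrm (T x)).
Proof.
move=> lT; split=> [x|x y|a x]; first exact: nrm_ge0.
- by rewrite (linP_D lT) nrmD.
- by rewrite (linP_Z lT) nrmZ.
Qed.

Lemma seminorm_add phi psi : seminorm phi -> seminorm psi ->
  seminorm (fun x => phi x + psi x).
Proof.
move=> [p0 pD pZ] [q0 qD qZ]; split=> [x|x y|a x].
- by rewrite addr_ge0.
- by rewrite addrACA lerD ?pD ?qD.
- by rewrite pZ qZ mulrDr.
Qed.

Lemma stable_add phi psi T : seminorm phi -> seminorm psi ->
  stable phi T -> stable psi T -> stable (fun x => phi x + psi x) T.
Proof.
move=> [p0 _ _] [q0 _ _] [M hM] [L hL]; exists (`|M| + `|L|) => x.
have := hM x; have := hL x; have := p0 x; have := q0 x.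
have := ler_norm M; have := ler_norm L; have := normr_ge0 M; have := normr_ge0 L.
nra.
Qed.

Lemma stable_nrm (D T : H -> H) : bounded_operator T -> linear D ->
  (forall x, D (T x) = T (D x)) -> stable (fun x => nrm (D x)) T.
Proof.
by move=> /bounded_nrm[M M0 hM] lD c; exists M => x; rewrite c.
Qed.

Lemma stable_shift phi T a : seminorm phi -> stable phi T ->
  stable phi (fun x => T x - a *: x).
Proof.
move=> [p0 pD pZ] [M hM]; exists (M + nrm a) => x.
by rewrite (le_trans (pD _ _)) // -scaleNr pZ nrmN mulrDl lerD ?hM.
Qed.

(* [s] is the norm of [T] on the approximate null space of [phi]; on vectors
   where it is nearly attained, [S T] is nearly [s ^ 2]. *)
Lemma top_modulus phi T S : (forall x, 0 <= phi x) -> approx_null phi ->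
  normal_pair T S -> stable phi T ->
  exists s : R, [/\ 0 <= s,
    forall b, s < b -> exists K, forall x, nrm (T x) <= b * nrm x + K * phi x
  & approx_null (fun x => phi x + nrm (S (T x) - ((s ^+ 2)%:C) *: x))].
Proof.
move=> p0 an [bT bS aTS cTS] [N0 hN0].
have [M M0 hM] := bounded_nrm bT.
pose N := `|N0|; have Nge0 : 0 <= N by rewrite normr_ge0.
have hN x : phi (T x) <= N * phi x.
  by rewrite (le_trans (hN0 x)) // ler_wpM2r // ler_norm.
(* The admissible bounds of [T] modulo [phi]; s is their infimum, and no s - d with d > 0 is
   admissible. *)
pose E := [set b : R | exists2 K : R, 0 <= K &
  forall x, nrm (T x) <= b * nrm x + K * phi x].
have E_ge0 b : E b -> 0 <= b.
  move=> [K K0 hb]; rewrite leNgt; apply/negP => b0.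
  have [|x x0 hx] := an (- b / (2 * (K + 1))); first by rewrite divr_gt0 //; lra.
  have xp := nrm_gt0 x0; have := hb x; have := nrm_ge0 (T x).
  have : K * phi x <= (K + 1) * (- b / (2 * (K + 1)) * nrm x).
    rewrite (le_trans (ler_wpM2l K0 hx)) // ler_wpM2r ?lerDl //.
    by rewrite mulr_ge0 ?nrm_ge0 // divr_ge0 //; lra.
  rewrite (_ : (K + 1) * _ = - b / 2 * nrm x); last by field; rewrite gt_eqF //; lra.
  nra.
have ME : E M by exists 0 => // x; rewrite mul0r addr0 hM.
have hE : has_inf E by split; [exists M|exists 0 => b /E_ge0].
pose s := inf E; have s0 : 0 <= s by apply: lb_le_inf => [|b /E_ge0//]; exists M.
have Eup b : s < b -> E b.
  move=> sb; have [|c [K K0 hc] cb] := @inf_adherent _ E (b - s) _ hE.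
    by rewrite subr_gt0.
  exists K => // x; rewrite (le_trans (hc x)) // lerD2r ler_wpM2r ?nrm_ge0 //.
  by move: cb; rewrite -/s; lra.
have Edown b : b < s -> ~ E b.
  by move=> bs hb; have := ge_inf hE.2 hb; rewrite -/s; lra.
exists s; split=> // [b /Eup[K _ h]|e e0]; first by exists K.
(* For the vector found below, |T T x| <= (s^2 + c d) |x| and the squared defect is at most Q d
   |x|^2; hence the choice of d. *)
pose c := 4 * s + 5; pose Q := 2 * s ^+ 2 * c + c ^+ 2 + 4 * s ^+ 3.
have c0 : 0 <= c by rewrite /c; lra.
have Q0 : 0 <= Q by rewrite /Q !addr_ge0 ?mulr_ge0 ?exprn_ge0.
have [d /and3P[d0 d1 dQ]] : exists d : R, [&& 0 < d, d <= 1 & Q * d <= (e / 2) ^+ 2].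
  exists (Num.min 1 ((e / 2) ^+ 2 / (Q + 1))).
  have e2 : 0 < (e / 2) ^+ 2 by rewrite exprn_gt0 // divr_gt0.
  have Q1 : 0 < Q + 1 by lra.
  rewrite lt_min ltr01 divr_gt0 //= ge_min lexx /=.
  apply: (@le_trans _ _ ((Q + 1) * ((e / 2) ^+ 2 / (Q + 1)))).
    by rewrite ler_pM ?ge_min ?lexx ?orbT // ?le_min ?ler01 ?divr_ge0 ?ltW //; lra.
  by rewrite mulrC divfK // gt_eqF.
have [K K0 hK] := Eup (s + d) ltac:(lra).
have Md : 0 < M + d by lra.
(* Once A phi(x) <= |x|, the first summand makes the [phi] terms negligible against d |x|, and the
   second keeps phi(x) within e/2 |x|. *)
pose A := (1 + K + K * N) / d + 2 / e.
have A0 : 0 <= A by rewrite addr_ge0 ?divr_ge0 ?addr_ge0 ?mulr_ge0 // ltW.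
(* Otherwise s - d would belong to [E]. The factor M + d turns the inequality, with |T x| <= M |x|,
   into A phi(x) <= |x|. *)
have [x hx] : exists x, (s - d) * nrm x + ((M + d) * A) * phi x < nrm (T x).
  apply/not_existsP => h; apply: (Edown (s - d)); first lra.
  exists ((M + d) * A) => [|x]; first by rewrite mulr_ge0 // ltW.
  by rewrite leNgt; apply/negP/h.
have x0 : x != 0.
  apply/eqP => x0; move: hx; rewrite x0 (linP_0 (bounded_lin bT)) nrm0 mulr0 add0r.
  by rewrite ltNge mulr_ge0 // mulr_ge0 // ltW.
exists x => //; have xp := nrm_gt0 x0; set X := nrm x in hx xp *.
have phA : A * phi x <= X.
  have : (M + d) * (A * phi x) <= (M + d) * X.
    have := hM x; rewrite -/X; nra.
  by rewrite ler_pM2l.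
have h0 := p0 x.
have ph1 : (1 + K + K * N) * phi x <= d * X.
  have : d * (A * phi x) <= d * X by rewrite ler_wpM2l // ltW.
  rewrite /A (_ : d * _ = (1 + K + K * N) * phi x + 2 * d / e * phi x); last first.
    by field; rewrite !gt_eqF.
  have : 0 <= 2 * d / e * phi x by rewrite mulr_ge0 // divr_ge0 ?mulr_ge0 // ltW.
  lra.
have ph2 : phi x <= e / 2 * X.
  have : e / 2 * (A * phi x) <= e / 2 * X by rewrite ler_wpM2l // divr_ge0 // ltW.
  rewrite /A (_ : e / 2 * _ = phi x + (1 + K + K * N) / d * (e / 2) * phi x); last first.
    by field; rewrite !gt_eqF.
  have : 0 <= (1 + K + K * N) / d * (e / 2) * phi x.
    by rewrite mulr_ge0 // mulr_ge0 // divr_ge0 ?addr_ge0 ?mulr_ge0 // ltW.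
  lra.
suff h : nrm (S (T x) - (s ^+ 2)%:C *: x) <= e / 2 * X by lra.
have KN : 0 <= K * N by rewrite mulr_ge0.
have KNp : 0 <= K * N * phi x by rewrite mulr_ge0.
have Kp : 0 <= K * phi x by rewrite mulr_ge0.
set a := nrm (T x) in hx; have a0 : 0 <= a := nrm_ge0 _.
have Ap : 0 <= (M + d) * A * phi x by rewrite !mulr_ge0 // ltW.
have a_up : a <= (s + 2 * d) * X by have := hK x; rewrite -/a -/X; lra.
have a_lo : (s - d) * X <= a by lra.
have t_up : nrm (T (T x)) <= (s ^+ 2 + c * d) * X.
  have h1 : nrm (T (T x)) <= (s + d) * a + K * (N * phi x).
    by rewrite (le_trans (hK _)) // lerD2l ler_wpM2l.
  have h2 : (s + d) * a <= (s + d) * ((s + 2 * d) * X) by rewrite ler_wpM2l //; lra.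
  have h3 : (s + d) * ((s + 2 * d) * X) + d * X <= (s ^+ 2 + c * d) * X.
    rewrite mulrA -mulrDl ler_wpM2r //; first exact: ltW.
    by rewrite /c; nra.
  lra.
have t2 : nrm (T (T x)) ^+ 2 <= (s ^+ 4 + (2 * s ^+ 2 * c + c ^+ 2) * d) * X ^+ 2.
  apply: (@le_trans _ _ (((s ^+ 2 + c * d) * X) ^+ 2)).
    rewrite lerXn2r ?nnegrE ?nrm_ge0 //.
    by rewrite mulr_ge0 ?(ltW xp) // addr_ge0 ?mulr_ge0 ?sqr_ge0 // ltW.
  rewrite exprMn ler_wpM2r ?sqr_ge0 // sqrrD -exprM exprMn.
  have : c ^+ 2 * d ^+ 2 <= c ^+ 2 * d by rewrite ler_wpM2l ?sqr_ge0 //; nra.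
  lra.
have a2 : (s ^+ 2 - 2 * s * d) * X ^+ 2 <= a ^+ 2.
  have [sd|sd] := leP s d.
    apply: (@le_trans _ _ 0); last exact: sqr_ge0.
    rewrite mulr_le0_ge0 ?sqr_ge0 //; nra.
  apply: (@le_trans _ _ (((s - d) * X) ^+ 2)).
    by rewrite exprMn ler_wpM2r ?sqr_ge0 //; nra.
  by rewrite lerXn2r ?nnegrE // mulr_ge0 ?(ltW xp) //; lra.
have D2 : nrm (S (T x) - (s ^+ 2)%:C *: x) ^+ 2
    = nrm (T (T x)) ^+ 2 - 2 * s ^+ 2 * a ^+ 2 + s ^+ 4 * X ^+ 2.
  rewrite sqr_nrmB ripZr (adj_sym aTS) -sqr_nrm (normal_nrm _ aTS cTS) nrmZ.
  rewrite nrm_real exprMn real_normK ?num_real // -/a -/X; ring.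
have xe : 0 <= e / 2 * X by rewrite mulr_ge0 ?divr_ge0 // ltW.
rewrite -(@ler_pXn2r _ 2) ?nnegrE ?nrm_ge0 // D2 exprMn.
have s20 : 0 <= s ^+ 2 by rewrite sqr_ge0.
have := ler_wpM2l s20 a2; have := ler_wpM2r (sqr_ge0 X) dQ; rewrite /Q.
lra.
Qed.

(** Adding the defect to [phi] preserves all that is needed to apply [top_modulus] again, so that
    several moduli can be fixed on the same vectors. *)
Lemma stable_defect phi T S s U : seminorm phi -> normal_pair T S ->
  bounded_operator U -> (forall x, T (U x) = U (T x)) ->
  (forall x, S (U x) = U (S x)) -> stable phi U ->
  seminorm (fun x => phi x + nrm (S (T x) - s *: x)) /\
  stable (fun x => phi x + nrm (S (T x) - s *: x)) U.
Proof.
move=> sp [bT bS _ _] bU cT cS st.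
have lD : linear (fun x => S (T x) - s *: x).
  exact: (bounded_lin (bounded_shift s (bounded_comp bS bT))).
have sD := seminorm_nrm lD; split; first exact: seminorm_add.
apply: stable_add => //; apply: stable_nrm => // x.
by rewrite cT cS (linP_B (bounded_lin bU)) (linP_Z (bounded_lin bU)).
Qed.

(** The scalar form, after pairing with a test vector, of the vector identity in
    [approx_eigenvalue]. The variables [i], [h], [c], [d] stand for the imaginary unit, one half and
    the conjugates of -1 and -i, so that [ring] can conclude. *)
Let polarization_identity (st s t x s1 s2 s3 i h c d : C) :
  i * i = -1 -> h * 2 = 1 -> c = -1 -> d = i ->
  t - - (1 - s2 + s1 + i * (1 - s3 + s1)) / 2 * x =
  h * (st - -1 * s - c * (t - -1 * x) - s2 * x - (st - s1 * x)
       + i * (st - - i * s - d * (t - - i * x) - s3 * x - (st - s1 * x))).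
Proof.
move=> i2 h2 -> ->; have -> : 2^-1 = h.
  by apply: (@mulIf _ 2); rewrite ?pnatr_eq0 // h2 mulVf // pnatr_eq0.
rewrite [RHS](_ : _ = h * (t + s + x - s2 * x + s1 * x + i * (s1 * x - s3 * x)
  + (i * i) * (s - t) - i * (i * i) * x)); last by ring.
rewrite i2; have {1}-> : t = h * 2 * t by rewrite h2 mul1r.
by ring.
Qed.

(* The moduli of [T], [T + 1] and [T + i] determine an eigenvalue. *)
Lemma approx_eigenvalue phi T S : seminorm phi -> approx_null phi ->
  normal_pair T S -> stable phi T ->
  exists l : C, approx_null (fun x => phi x + nrm (T x - l *: x)).
Proof.
move=> sp an npT st; have [bT bS aTS cTS] := npT.
have lT := bounded_lin bT; have lS := bounded_lin bS.
have [s1 [_ _ an1]] := top_modulus (let: And3 h _ _ := sp in h) an npT st.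
have [sp1 st1] := stable_defect (s1 ^+ 2)%:C sp npT bT
  (fun=> erefl) (fun x => esym (cTS x)) st.
have np2 := normal_pair_shift (-1) npT.
have [s2 [_ _ an2]] := top_modulus (let: And3 h _ _ := sp1 in h) an1 np2
  (stable_shift _ sp1 st1).
have cS1 x : S (T x) - (-1)^* *: T x = T (S x - (-1)^* *: x).
  by rewrite (linP_B lT) (linP_Z lT); have /= -> := cTS x.
have cT1 x : T (T x) - (-1) *: T x = T (T x - (-1) *: x).
  by rewrite (linP_B lT) (linP_Z lT).
have [sp2 st2] := stable_defect (s2 ^+ 2)%:C sp1 np2 bT cT1 cS1 st1.
have np3 := normal_pair_shift (- 'i) npT.
have [s3 [_ _ an3]] := top_modulus (let: And3 h _ _ := sp2 in h) an2 np3
  (stable_shift _ sp2 st2).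
(* If |l| = s1, |l + 1| = s2 and |l + i| = s3, then expanding the squares gives Re l = - p/2 and Im
   l = - q/2. *)
pose p : C := 1 - (s2 ^+ 2)%:C + (s1 ^+ 2)%:C.
pose q : C := 1 - (s3 ^+ 2)%:C + (s1 ^+ 2)%:C.
exists (- (p + 'i * q) / 2); apply: approx_null_le an3 => x /=.
set E1 := S (T x) - _; set E2 := _ - (s2 ^+ 2)%:C *: _; set E3 := _ - (s3 ^+ 2)%:C *: _.
have -> : T x - (- (p + 'i * q) / 2) *: x =
    (1 / 2)%:C *: ((E2 - E1) + 'i *: (E3 - E1)).
  apply: inner_ext => z; rewrite /E1 /E2 /E3 !(linP_B lS, linP_Z lS).
  have hi : 'i * 'i = -1 :> C by rewrite -expr2 sqr_i.
  have cN1 : (-1 : C)^* = -1 by rewrite rmorphN1.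
  have ci : (- 'i : C)^* = 'i.
    by rewrite rmorphN complexiE /=; apply/eqP; rewrite eqr_oppLR; apply/eqP; exact: conjCi.
  have h2 : (1 / 2)%:C * 2 = 1 :> C.
    by rewrite rmorphM rmorph1 fmorphV rmorph_nat mul1r mulVf // pnatr_eq0.
  rewrite !innerE; exact: polarization_identity.
rewrite nrmZ nrm_real ger0_norm //.
have := nrmD (E2 - E1) ('i *: (E3 - E1)); rewrite nrmZ nrm_i mul1r.
have := nrmD E2 (- E1); have := nrmD E3 (- E1); rewrite !nrmN.
have := nrm_ge0 E2; have := nrm_ge0 E3; lra.
Qed.

End ApproximateNull.

(** * Koszul exactness *)

Section WeakBoundedness.
Context {R : realType} {H : hilbertType R}.
Local Notation C := R[i].

(* Gliding hump: if [phi] were approximately null, unit steps of size [3 ^- k]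
   along vectors [u k] of norm [2 (k + 1) 3 ^ k] with [phi (u k) <= 1] would
   lead to a point whose pairing with [u k] is at least [k + 1]. *)
Lemma weakly_bounded_not_null (phi : H -> R) :
  (forall a x, phi (a *: x) = nrm a * phi x) ->
  (forall x : H, exists K : R, forall u, `|rip x u| <= K * phi u) ->
  (forall x, 0 <= phi x) -> ~ approx_null phi.
Proof.
move=> phiZ wb p0 an.
pose h k : R := 2 * k.+1%:R * 3 ^+ k.
have h0 k : 0 < h k by rewrite !mulr_gt0 // exprn_gt0.
have /choice[u hu] : forall k, exists v, nrm v = h k /\ phi v <= 1.
  move=> k.
  have [|v v0 hv] := an (h k)^-1; first by rewrite invr_gt0.
  have vp := nrm_gt0 v0; have vk : 0 < h k / nrm v by rewrite divr_gt0.
  exists ((h k / nrm v)%:C *: v); rewrite nrmZ phiZ nrm_real gtr0_norm //.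
  split; first by rewrite divfK // gt_eqF.
  apply: (@le_trans _ _ (h k / nrm v * ((h k)^-1 * nrm v))).
    by rewrite ler_wpM2l // ltW.
  by rewrite (_ : _ * _ = 1) //; field; rewrite !gt_eqF.
pose c k : R := 3 ^- k / h k.
have c0 k : 0 <= c k by rewrite divr_ge0 ?invr_ge0 ?exprn_ge0 // ltW.
(* The sign agrees with that of the current pairing, so the new step can only increase its absolute
   value. *)
pose sg k (x : H) : R := if 0 <= rip x (u k) then c k else - c k.
have nsg k x : `|sg k x| = c k.
  by rewrite /sg; case: ifP => _; rewrite ?normrN ger0_norm.
pose fix x k := if k is j.+1 then x j + (sg j (x j))%:C *: u j else 0.
have xS k : x k.+1 = x k + (sg k (x k))%:C *: u k by [].
have step k : nrm (x k.+1 - x k) = 3 ^- k.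
  rewrite xS addrAC subrr add0r nrmZ nrm_real nsg (hu k).1 /c divfK // gt_eqF //.
have [|||l hl] := @geometric_limit R H x 1 (3^-1); first by rewrite invr_ge0.
- by rewrite invf_lt1 // ltr1n.
- by move=> k; rewrite step mul1r exprVn.
have hump k : 3 ^- k * h k <= `|rip (x k.+1) (u k)|.
  rewrite xS ripDl ripZl -sqr_nrm (hu k).1 (_ : 3 ^- k * h k = c k * h k ^+ 2); last first.
    by rewrite /c; field; rewrite !gt_eqF // exprn_gt0.
  have ch : 0 <= c k * h k ^+ 2 by rewrite mulr_ge0 ?sqr_ge0.
  rewrite /sg; case: ifPn => [r0|]; first by rewrite ger0_norm ?lerDr ?addr_ge0.
  rewrite -ltNge mulNr => r0; rewrite ltr0_norm; last lra.
  lra.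
have th : 1 / (1 - 3^-1) = 3 / 2 :> R.
  have -> : 1 - 3^-1 = 2 / 3 :> R by lra.
  by rewrite div1r invf_div.
(* All steps after the k-th one together measure at most half of 3^-k, so at least half of the hump
   survives in the limit, namely 3^-k h(k) / 2 = k + 1. *)
have low k : k.+1%:R <= `|rip l (u k)|.
  have e1 : `|rip (l - x k.+1) (u k)| <= (1 / 2) * 3 ^- k * h k.
    have := hl k.+1; rewrite exprS exprVn => hl1.
    have hl2 : nrm (l - x k.+1) <= 1 / 2 * 3 ^- k.
      by apply: (le_trans hl1); rewrite th mulrA ler_wpM2r ?invr_ge0 ?exprn_ge0 //; lra.
    have r1 := rip_le (l - x k.+1) (u k); have r2 := rip_le (- (l - x k.+1)) (u k).
    rewrite ripNl nrmN (hu k).1 in r1 r2.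
    have hl3 := ler_wpM2r (ltW (h0 k)) hl2.
    by rewrite ler_norml; apply/andP; split; lra.
  have e2 : `|rip (x k.+1) (u k)| <= `|rip l (u k)| + `|rip (l - x k.+1) (u k)|.
    rewrite (_ : rip (x k.+1) (u k) = rip l (u k) - rip (l - x k.+1) (u k)).
      exact: ler_normB.
    by rewrite (ripDl l) (ripNl (x k.+1)); ring.
  have e3 := hump k.
  have e4 : 1 / 2 * (3 ^- k * h k) = k.+1%:R.
    by rewrite /h; field; rewrite expf_neq0.
  lra.
have [K hK] := wb l; have := low (Num.truncn `|K|).
have := truncnS_gt `|K|; have := hK (u (Num.truncn `|K|)).
have := (hu (Num.truncn `|K|)).2; have := p0 (u (Num.truncn `|K|)).
move=> q0 q1 q2 q3; rewrite leNgt => /negP; apply.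
apply: le_lt_trans q2 _; apply: le_lt_trans q3.
by have := ler_norm K; have := normr_ge0 K; nra.
Qed.

End WeakBoundedness.

(** * Inversion of coercive operators *)

Section Coercive.
Context {R : realType} {H : hilbertType R}.

(** The iteration x - t (D x - y) converges to a preimage of y: with t = c / M^2 the map x - t D x
    contracts by q, where q^2 = 1 - c^2 / M^2. *)
Lemma coercive_inverse (D : H -> H) (c : R) : bounded_operator D -> 0 < c ->
  (forall x, c * nrm x ^+ 2 <= rip (D x) x) ->
  exists E : H -> H, [/\ linear E, cancel D E & cancel E D].
Proof.
move=> bD c0 hc; have lD := bounded_lin bD; have [M0 M00 hM0] := bounded_nrm bD.
(* Enlarging the bound by c ensures c <= M, so that q^2 is nonnegative. *)
pose M := M0 + c; have M1 : 0 < M by rewrite addr_gt0.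
have hM x : nrm (D x) <= M * nrm x.
  by rewrite (le_trans (hM0 x)) // ler_wpM2r ?nrm_ge0 // /M; lra.
have inj x y : D x = D y -> x = y.
  move=> e; apply/eqP; rewrite -subr_eq0; apply/eqP/nrm_eq0/eqP.
  rewrite -sqrf_eq0 eq_le sqr_ge0 andbT -(pmulr_rle0 _ c0).
  rewrite (le_trans (hc _)) // (linP_B lD) e subrr.
  by rewrite -(scale0r 0) (ripZl 0) mul0r.
pose t := c / M ^+ 2; have t0 : 0 < t by rewrite divr_gt0 // exprn_gt0.
pose q2 := 1 - c ^+ 2 / M ^+ 2.
have cM : c ^+ 2 / M ^+ 2 <= 1.
  rewrite ler_pdivrMr ?exprn_gt0 // mul1r lerXn2r ?nnegrE ?ltW // /M; lra.
have cM0 : 0 < c ^+ 2 / M ^+ 2 by rewrite divr_gt0 // exprn_gt0.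
pose q := Num.sqrt q2.
have q0 : 0 <= q by rewrite sqrtr_ge0.
have qq : q ^+ 2 = q2 by rewrite sqr_sqrtr // /q2; lra.
have q1 : q < 1.
  by rewrite -(@ltr_pXn2r _ 2) ?nnegrE // expr1n qq /q2; lra.
have contr x : nrm (x - t%:C *: D x) <= q * nrm x.
  rewrite -(@ler_pXn2r _ 2) ?nnegrE ?nrm_ge0 ?mulr_ge0 ?nrm_ge0 // exprMn qq.
  rewrite sqr_nrmB ripZr (ripC x) nrmZ nrm_real gtr0_norm // exprMn.
  have h1 := ler_wpM2l (ltW t0) (hc x).
  have h2 : t ^+ 2 * nrm (D x) ^+ 2 <= t ^+ 2 * (M * nrm x) ^+ 2.
    by rewrite ler_wpM2l ?sqr_ge0 // lerXn2r ?nnegrE ?nrm_ge0 ?mulr_ge0 ?nrm_ge0 ?(ltW M1).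
  have h3 : t ^+ 2 * (M * nrm x) ^+ 2 = t * (c * nrm x ^+ 2).
    by rewrite /t; field; rewrite gt_eqF.
  have h4 : t * (c * nrm x ^+ 2) = c ^+ 2 / M ^+ 2 * nrm x ^+ 2.
    by rewrite /t; field; rewrite gt_eqF.
  rewrite /q2; lra.
have surj y : exists x, D x = y.
  pose f x := x - t%:C *: (D x - y); pose x k := iter k f 0.
  have res k : nrm (D (x k) - y) <= nrm (D 0 - y) * q ^+ k.
    elim: k => [|k ih]; first by rewrite expr0 mulr1.
    rewrite (_ : D (x k.+1) - y = (D (x k) - y) - t%:C *: D (D (x k) - y)).
      by rewrite (le_trans (contr _)) // exprS mulrCA ler_wpM2l.
    by rewrite /x iterS {1}/f (linP_B lD) (linP_Z lD) addrAC.
  have [|l hl] := @geometric_limit R H x (t * nrm (D 0 - y)) q q0 q1.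
    move=> k; rewrite /x iterS {1}/f addrAC subrr add0r nrmN nrmZ nrm_real gtr0_norm //.
    by rewrite -mulrA ler_wpM2l ?res // ltW.
  exists l; apply/eqP; rewrite -subr_eq0; apply/eqP/nrm_eq0/le_anti.
  rewrite nrm_ge0 andbT.
  set B := t * nrm (D 0 - y) / (1 - q) in hl.
  apply: (@ge0_le_eps _ _ (M * B + nrm (D 0 - y))) => e e0.
  have qc : (fun k => q ^+ k) @ \oo --> (0 : R) by apply: cvg_expr; rewrite ger0_norm.
  have /cvgrPdist_lt/(_ _ e0)[k _ hk] := qc.
  have := hk k (leqnn _); rewrite sub0r normrN ger0_norm ?exprn_ge0 // => /ltW qk.
  have qk0 : 0 <= q ^+ k by rewrite exprn_ge0.
  rewrite -(subrKA (D (x k))) (le_trans (nrmD _ _)) // -(linP_B lD).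
  have h1 := hM (l - x k); have h2 := ler_wpM2l (ltW M1) (hl k).
  have B0 : 0 <= B by rewrite /B; apply: divr_ge0; [exact: mulr_ge0 (ltW t0) (nrm_ge0 _)|lra].
  have h3 := ler_wpM2l (mulr_ge0 (ltW M1) B0) qk.
  have h4 := ler_wpM2l (nrm_ge0 (D 0 - y)) qk.
  have h5 := res k; lra.
have [E hE] := choice surj.
have DE : cancel D E by move=> x; apply: inj; rewrite hE.
by exists E; split=> // a x y; apply: inj; rewrite lD !hE.
Qed.

End Coercive.

Section Koszul.
Context {R : realType} {H : hilbertType R} (n : nat).
Local Notation C := R[i].
Implicit Types (T B : 'I_n -> H -> H) (A : {set 'I_n}).

(** An element of top degree is always a cycle; writing it as a boundary puts x in the sum of the
    ranges. *)
Lemma koszul_exact_top T : (forall i, linear (T i)) -> koszul_exact T ->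
  forall x, exists y : 'I_n -> H, x = \sum_i T i (y i).
Proof.
move=> lT ex x.
have [|g hg] := ex [ffun A => if A == [set: 'I_n]%SET then x else 0].
  apply/ffunP => A; rewrite !ffunE big1 // => i iA; rewrite ffunE.
  case: eqP => [e|_]; last by rewrite (linP_0 (lT i)) scaler0.
  by have := finset.in_setT i; rewrite -e !inE eqxx.
move/ffunP/(_ [set: 'I_n]%SET): hg; rewrite !ffunE eqxx => ->.
exists (fun i : 'I_n => (-1) ^+ #|[set j in [set: 'I_n] | (j < i)%N]%SET| *: g ([set: 'I_n]%SET :\ i)).
by apply: eq_big => [i|i _]; rewrite ?inE // (linP_Z (lT i)).
Qed.

Let sgn (i : 'I_n) A : C := (-1) ^+ #|[set j in A | (j < i)%N]%SET|.

Let sgn_sqr i A : sgn i A * sgn i A = 1.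
Proof. by rewrite -exprD addnn -mul2n exprM sqrrN expr1n expr1n. Qed.

Let sgn_D1 (i k : 'I_n) A : k \in A ->
  sgn i A = (-1) ^+ (k < i)%N * sgn i (A :\ k).
Proof.
move=> kA; rewrite /sgn (cardsD1 k) !inE kA /= exprD; congr (_ * _ ^+ _).
by apply: eq_card => j; rewrite !inE; case: (j == k); rewrite ?andbF.
Qed.

(* [h] below is a contracting homotopy. *)
Lemma koszul_exact_unit T B : (forall i, linear (T i)) -> (forall i, linear (B i)) ->
  (forall i k x, T i (B k x) = B k (T i x)) ->
  (forall x, \sum_i T i (B i x) = x) -> koszul_exact T.
Proof.
move=> lT lB c TB f f0.
pose h : {ffun {set 'I_n} -> H} :=
  [ffun A : {set 'I_n} => \sum_(i | i \notin A) sgn i A *: B i (f (i |: A))].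
exists h; apply/ffunP => A.
have d0 (D : {set 'I_n}) : \sum_(i in D) sgn i D *: T i (f (D :\ i)) = 0.
  by move/ffunP/(_ D): f0; rewrite !ffunE.
(* The homotopy applied to the differential of [f], which is zero; adding it turns the goal into the
   identity dh + hd = 1. *)
have hd : \sum_(k | k \notin A) sgn k A *:
    B k (\sum_(i in k |: A) sgn i (k |: A) *: T i (f ((k |: A) :\ i))) = 0.
  by apply: big1 => k _; rewrite d0 (linP_0 (lB k)) scaler0.
rewrite -[LHS]addr0 -[X in _ + X = _]oppr0 -hd ffunE.
(* The off-diagonal terms, which occur in dh and hd with opposite signs because exactly one of i < k
   and k < i holds. *)
pose cross := \sum_(i in A) \sum_(k | k \notin A)
  (sgn i A * sgn k (A :\ i)) *: T i (B k (f (k |: (A :\ i)))).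
have -> : \sum_(i in A) sgn i A *: T i (h (A :\ i)) =
    \sum_(i in A) T i (B i (f A)) + cross.
  rewrite -big_split /=; apply: eq_bigr => i iA.
  rewrite ffunE (bigD1 i) /=; last by rewrite !inE eqxx.
  rewrite finset.setD1K // (linP_D (lT i)) scalerDr (linP_Z (lT i)) scalerA.
  rewrite (sgn_D1 i iA) ltnn mul1r sgn_sqr scale1r; congr (_ + _).
  rewrite (linP_sum (lT i)) scaler_sumr; apply: eq_big => [k|k].
    by rewrite !inE; case: eqP => [->|_]; rewrite ?iA ?andbT ?andbF ?eqxx.
  by move=> _; rewrite (linP_Z (lT i)) scalerA.
have -> : \sum_(k | k \notin A) sgn k A *:
    B k (\sum_(i in k |: A) sgn i (k |: A) *: T i (f ((k |: A) :\ i))) =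
    \sum_(k | k \notin A) T k (B k (f A)) - cross.
  rewrite /cross exchange_big /= -sumrN -big_split /=; apply: eq_bigr => k kA.
  rewrite (bigD1 k) /=; last by rewrite !inE eqxx.
  rewrite finset.setU1K // (linP_D (lB k)) scalerDr (linP_Z (lB k)) scalerA -c.
  have -> : sgn k (k |: A) = sgn k A.
    by rewrite (@sgn_D1 k k) ?finset.setU11 // ltnn mul1r finset.setU1K.
  rewrite sgn_sqr scale1r; congr (_ + _).
  rewrite (linP_sum (lB k)) scaler_sumr -sumrN; apply: eq_big => [i|i].
    by rewrite !inE; case: eqP => [->|_]; rewrite ?(negbTE kA) ?andbT ?andbF ?eqxx.
  rewrite !inE => /andP[ikA ik]; have iA : i \in A by move: ikA; rewrite (negbTE ik).
  rewrite (linP_Z (lB k)) scalerA -c -scaleNr.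
  have -> : (k |: A) :\ i = k |: (A :\ i).
    by apply/setP => j; rewrite !inE; case: (eqVneq j k) => [->|//]; rewrite eq_sym (negbTE ik).
  congr (_ *: _); rewrite (sgn_D1 k iA) (@sgn_D1 i k (k |: A)) ?finset.setU11 // finset.setU1K //.
  have : (i < k)%N (+) (k < i)%N by move: ik; rewrite -val_eqE /=; case: ltngtP.
  by case: (i < k)%N; case: (k < i)%N => // _; rewrite ?expr1 ?expr0; ring.
apply/eqP; rewrite subr_eq addrACA subrr addr0; apply/eqP.
by rewrite -[LHS]TB (bigID (mem A)).
Qed.

End Koszul.

(** * The joint spectrum of a normal tuple *)

Section JointSpectrum.
Context {R : realType} {H : hilbertType R} (n : nat).
Local Notation C := R[i].
Implicit Types (N : 'I_n -> H -> H) (l : 'I_n -> C).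

Definition joint_defect N l x : R := \sum_i nrm (N i x - l i *: x).

Lemma joint_defect_ge0 N l x : 0 <= joint_defect N l x.
Proof. by apply: sumr_ge0 => i _; exact: nrm_ge0. Qed.

Lemma joint_defect_ge N l x i : nrm (N i x - l i *: x) <= joint_defect N l x.
Proof.
rewrite /joint_defect (bigD1 i) //= lerDl.
by apply: sumr_ge0 => j _; exact: nrm_ge0.
Qed.

Lemma not_approx_null (phi : H -> R) : ~ approx_null phi ->
  exists2 e : R, 0 < e & forall x, x != 0 -> e * nrm x < phi x.
Proof.
move=> h; apply: contrapT => h2; apply: h => e e0.
apply: contrapT => h3; apply: h2; exists e => // x x0.
by rewrite ltNge; apply/negP => hx; apply: h3; exists x.
Qed.

(** Exactness writes every x as a sum of T_i y_i, so by normality the pairing of x with u is at most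
    the joint defect of u times the sum of the |y_i|. Then [weakly_bounded_not_null] applies. *)
Lemma approx_null_spectrum N N' l : (forall i, normal_pair (N i) (N' i)) ->
  approx_null (joint_defect N l) -> joint_spectrum N l.
Proof.
move=> np an; rewrite /joint_spectrum /= => ex.
pose T i x := N i x - l i *: x; pose S i x := N' i x - (l i)^* *: x.
have npT i : normal_pair (T i) (S i) := normal_pair_shift (l i) (np i).
have lT i : linear (T i) by have [/bounded_lin] := npT i.
have onto := koszul_exact_top lT ex.
apply: (weakly_bounded_not_null _ _ (joint_defect_ge0 N l) an) => [a x|x].
  rewrite mulr_sumr; apply: eq_bigr => i _.
  by rewrite -nrmZ -(linP_Z (lT i)).
have [y ->] := onto x; exists (\sum_i nrm (y i)) => u.
have rip_sum (I : Type) (s : seq I) (F : I -> H) : rip (\sum_(i <- s) F i) u = \sum_(i <- s) rip (F i) u.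
  elim: s => [|i s ih]; last by rewrite !big_cons ripDl ih.
  by rewrite !big_nil -(scale0r 0) (ripZl 0) mul0r.
rewrite rip_sum (le_trans (ler_norm_sum _ _ _)) // mulr_suml.
apply: ler_sum => i _; have [_ _ a c] := npT i.
apply: (@le_trans _ _ (nrm (y i) * nrm (T i u))); last first.
  by rewrite ler_wpM2l ?nrm_ge0 // joint_defect_ge.
rewrite a -(normal_nrm u a c) ler_norml rip_le andbT lerNl -ripNl.
by rewrite -(nrmN (y i)) rip_le.
Qed.

Definition doubly_commuting N N' := [/\ forall i, normal_pair (N i) (N' i),
  commuting_tuple N & forall i j, N' i \o N j =1 N j \o N' i].

Lemma doubly_commuting_adj N N' : doubly_commuting N N' ->
  forall i j, N' i \o N' j =1 N' j \o N' i.
Proof.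
move=> [np c d] i j; have [_ _ ai _] := np i; have [_ _ aj _] := np j.
exact: adj_commute ai aj (c i j).
Qed.

Lemma unitary_doubly_commuting X N : unitary_tuple X N ->
  exists N', doubly_commuting N N'.
Proof.
move=> [c no _].
have /choice[N' hN'] : forall i, exists S, normal_pair (N i) S.
  by move=> i; have [b [S aS cS]] := no i; exists S; split=> //;
    [case: aS|exact: is_adjoint_adj].
exists N'; split=> // i j; have [bi bi' a c1] := hN' i; have [bj _ _ _] := hN' j.
exact: fuglede bi bi' bj a c1 (c i j).
Qed.

Lemma spectrum_approx_null N N' l : doubly_commuting N N' ->
  joint_spectrum N l -> approx_null (joint_defect N l).
Proof.
move=> dN sp; apply: contrapT => /not_approx_null[e e0 he]; apply: sp.
have [np cN dc] := dN; have dc' := doubly_commuting_adj dN.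
pose T i x := N i x - l i *: x; pose S i x := N' i x - (l i)^* *: x.
have npT i : normal_pair (T i) (S i) := normal_pair_shift (l i) (np i).
have bT i : bounded_operator (T i) by have [] := npT i.
have bS i : bounded_operator (S i) by have [] := npT i.
have lT i := bounded_lin (bT i); have lS i := bounded_lin (bS i).
have lN i : linear (N i) by have [/bounded_lin] := np i.
have lN' i : linear (N' i) by have [_ /bounded_lin] := np i.
have cTT i j x : T i (T j x) = T j (T i x).
  rewrite /T !(linP_B (lN _), linP_Z (lN _)); have /= -> := cN i j x.
  by apply: inner_ext => z; rewrite !innerE; ring.
have cTS i j x : T i (S j x) = S j (T i x).
  rewrite /T /S !(linP_B (lN _), linP_Z (lN _), linP_B (lN' _), linP_Z (lN' _)).
  by have /= -> := dc j i x; apply: inner_ext => z; rewrite !innerE; ring.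
pose D x := \sum_i S i (T i x).
have bD : bounded_operator D by apply: bounded_sum => i; exact: bounded_comp.
have coer x : e ^+ 2 / n.+1%:R * nrm x ^+ 2 <= rip (D x) x.
  have -> : rip (D x) x = \sum_i nrm (T i x) ^+ 2.
    rewrite /D; elim/big_ind2: _ => [|a b u v <- <-|i _].
    - by rewrite -(scale0r 0) (ripZl 0) mul0r.
    - by rewrite ripDl.
    - by have [_ _ a _] := npT i; rewrite (adj_sym a) -sqr_nrm.
  have h1 : e * nrm x <= joint_defect N l x.
    have [->|x0] := eqVneq x 0; last by rewrite ltW // he.
    by rewrite nrm0 mulr0 joint_defect_ge0.
  (* Cauchy-Schwarz, by summing (a - t)^2 >= 0 over the operators; n + 1 in place of n keeps the
     denominator positive for the empty tuple. *)
  set J := joint_defect N l x in h1; have [t ht] : exists t, t = J / n.+1%:R by eexists.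
  have n0 : 0 < n.+1%:R :> R by rewrite ltr0n.
  have J0 : 0 <= J := joint_defect_ge0 _ _ _.
  have h2 : \sum_i (2 * t * nrm (T i x) - t ^+ 2) <= \sum_i nrm (T i x) ^+ 2.
    apply: ler_sum => i _; have := sqr_ge0 (nrm (T i x) - t).
    set a := nrm _; lra.
  rewrite sumrB -mulr_sumr (_ : \sum_i nrm (T i x) = J) // sumr_const card_ord in h2.
  have h3 : t ^+ 2 *+ n <= t ^+ 2 *+ n.+1 by rewrite mulrSr lerDl sqr_ge0.
  have h4 : 2 * t * J - t ^+ 2 *+ n.+1 = J ^+ 2 / n.+1%:R.
    by rewrite -mulr_natr ht; field; rewrite gt_eqF.
  have h5 : (e * nrm x) ^+ 2 / n.+1%:R <= J ^+ 2 / n.+1%:R.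
    by rewrite ler_pM2r ?invr_gt0 // lerXn2r ?nnegrE // mulr_ge0 ?nrm_ge0 // ltW.
  apply: le_trans h2; apply: le_trans (lerB (lexx _) h3).
  by rewrite h4; apply: le_trans h5; rewrite exprMn mulrAC.
have [|E [lE DE ED]] := coercive_inverse bD _ coer.
  by rewrite divr_gt0 ?exprn_gt0 // ltr0n.
have cTE i x : T i (E x) = E (T i x).
  apply: (can_inj DE); rewrite ED.
  rewrite -{2}(ED x) /D (linP_sum (lT i)); apply: eq_bigr => j _.
  by rewrite cTS cTT.
apply: (@koszul_exact_unit _ _ _ _ (fun i x => E (S i x))) => //.
- by move=> i a x y; rewrite lS lE.
- by move=> i k x; rewrite -/(T i _) cTE cTS.
- move=> x; under eq_bigr => i _ do rewrite -/(T i _) cTE cTS.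
  by rewrite -(linP_sum lE) DE.
Qed.

Lemma seminorm_joint_defect N l : (forall i, linear (N i)) ->
  seminorm (joint_defect N l).
Proof.
move=> lN; have sp i : seminorm (fun x => nrm (N i x - l i *: x)).
  apply: seminorm_nrm => a x y; rewrite lN.
  by apply: inner_ext => z; rewrite !innerE; ring.
split=> [x|x y|a x]; first exact: joint_defect_ge0.
- by rewrite -big_split; apply: ler_sum => i _; have [_ h _] := sp i; exact: h.
- by rewrite mulr_sumr; apply: eq_bigr => i _; have [_ _ h] := sp i; exact: h.
Qed.

(** Induction on the list of indices: the defect of each eigenvalue found is added to the seminorm,
    which stays stable under the remaining operators since they commute. *)
Lemma approx_eigenvalues (phi : H -> R) N N' : seminorm phi -> approx_null phi ->
  (forall i, normal_pair (N i) (N' i)) -> commuting_tuple N ->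
  (forall i, stable phi (N i)) ->
  exists l, approx_null (fun x => phi x + joint_defect N l x).
Proof.
move=> sp an np cN st.
suff [l [_ _ anl]] : exists l, let psi := fun x =>
    phi x + \sum_(i <- enum 'I_n) nrm (N i x - l i *: x) in
    [/\ seminorm psi, forall i, stable psi (N i) & approx_null psi].
  by exists l; apply: approx_null_le anl => x; rewrite /joint_defect big_enum.
elim: (enum _) (enum_uniq 'I_n) => [_|i s ih /= /andP[iNs us]].
  exists (fun=> 0) => psi; have -> // : psi = phi.
  by apply/funext => x; rewrite /psi big_nil addr0.
have [l [spl stl anl]] := ih us.
have [a ana] := approx_eigenvalue spl anl (np i) (stl i).
have eqs x : \sum_(j <- s) nrm (N j x - (if j == i then a else l j) *: x) =
    \sum_(j <- s) nrm (N j x - l j *: x).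
  rewrite !big_seq; apply: eq_bigr => j js.
  by case: eqP => // e; rewrite -e js in iNs.
exists (fun j => if j == i then a else l j).
have [bi _ _ _] := np i; have lD := bounded_lin (bounded_shift a bi).
have -> : (fun x => phi x + \sum_(j <- i :: s)
    nrm (N j x - (if j == i then a else l j) *: x)) =
    fun x => (phi x + \sum_(j <- s) nrm (N j x - l j *: x)) + nrm (N i x - a *: x).
  by apply/funext => x; rewrite big_cons eqxx eqs addrCA addrC.
split=> // [|j]; first exact: seminorm_add spl (seminorm_nrm lD).
have [bj _ _ _] := np j.
apply: stable_add => //; first exact: seminorm_nrm.
apply: stable_nrm => // x; rewrite (linP_B (bounded_lin bj)) (linP_Z (bounded_lin bj)).
by have /= -> := cN i j x.
Qed.

(** Were the self-adjoint T = N_k^* N_k - 1 nonzero, [top_modulus] would give s > 0 and vectors with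
    T T x close to s^2 x. Refining these to joint approximate eigenvectors yields a spectral point
    with |l_k| = 1, which makes T x small on them. *)
Lemma spectrum_unimodular_isometric N N' k : doubly_commuting N N' ->
  (forall l, joint_spectrum N l -> nrm (l k) = 1) ->
  forall x, nrm (N k x) = nrm x.
Proof.
move=> dN sp; have [np cN dc] := dN; have [bk bk' ak ck] := np k.
pose T x := N' k (N k x) - x.
have [T0|/existsNP[x0 Tx0]] := pselect (forall x, T x = 0).
  move=> x; apply/eqP; rewrite -(@eqrXn2 _ 2) ?nrm_ge0 // !sqr_nrm ak.
  by have /eqP := T0 x; rewrite subr_eq0 => /eqP ->.
exfalso; have lk := bounded_lin bk; have lk' := bounded_lin bk'.
have bT : bounded_operator T.
  have -> : T = fun x => N' k (N k x) - 1 *: x by apply/funext => x; rewrite scale1r.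
  exact: (bounded_shift 1 (bounded_comp bk' bk)).
have lT := bounded_lin bT.
have npT : normal_pair T T.
  split=> // x y; rewrite /T ripDl ripDr ripNl (ripC x (- y)) ripNl (ripC y).
  by rewrite (adj_sym ak) ak.
have x00 : x0 != 0 by apply/eqP => e; apply: Tx0; rewrite e (linP_0 lT).
have an0 : approx_null (fun _ : H => 0 : R).
  by move=> e e0; exists x0 => //; rewrite mulr_ge0 ?nrm_ge0 // ltW.
have sp0 : seminorm (fun _ : H => 0 : R).
  by split=> [x|x y|a x]; rewrite ?addr0 ?mulr0.
have st0 U : stable (fun _ : H => 0 : R) U by exists 0 => x; rewrite mul0r.
have [s [s0 hs an1]] := top_modulus (fun=> lexx _) an0 npT (st0 T).
have s_gt0 : 0 < s.
  rewrite lt_def s0 andbT; apply/eqP => se; apply: Tx0; apply: nrm_eq0.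
  apply/le_anti; rewrite nrm_ge0 andbT; apply: (@ge0_le_eps _ _ (nrm x0)) => e e0.
  have [|K hK] := hs e; first by rewrite se.
  by have := hK x0; rewrite mulr0 addr0 mulrC.
have cTN i x : T (N i x) = N i (T x).
  have [/bounded_lin li _ _ _] := np i; rewrite /T (linP_B li).
  by have /= -> := cN k i x; have /= -> := dc k i (N k x).
have std i := stable_defect (s ^+ 2)%:C sp0 npT (let: And4 h _ _ _ := np i in h)
  (cTN i) (cTN i) (st0 (N i)).
have [l anl] := approx_eigenvalues (std k).1 an1 np cN (fun i => (std i).2).
have lk1 : nrm (l k) = 1.
  apply: sp; apply: (approx_null_spectrum np); apply: approx_null_le anl => x.
  by rewrite lerDr addr_ge0 ?nrm_ge0.
have [M M0 hM] := bounded_nrm bk'; have [L L0 hL] := bounded_nrm bT.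
have B0 : 0 < 1 + L * (M + 1) by rewrite addr_gt0 // mulr_gt0 // addr_gt0.
(* With this tolerance the two error terms together amount to at most half of s^2 |x|. *)
have [|x xn0 hx] := anl (s ^+ 2 / (2 * (1 + L * (M + 1)))).
  by rewrite divr_gt0 ?exprn_gt0 // mulr_gt0.
have xp := nrm_gt0 xn0; set e := s ^+ 2 / _ in hx.
have h1 := joint_defect_ge N l x k.
have h2 := joint_defect_ge0 N l x.
rewrite add0r in hx.
have [_ _ as' cs'] := normal_pair_shift (l k) (np k).
have h3 := normal_nrm x as' cs'.
have ll : l k * (l k)^* = 1.
  by rewrite -[LHS]/(l k * conjc (l k)) -sqr_normc nrmE lk1 expr1n.
have h4 : nrm (T x) <= (M + 1) * nrm (N k x - l k *: x).
  have -> : T x = N' k (N k x - l k *: x) + l k *: (N' k x - (l k)^* *: x).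
    rewrite (linP_B lk') (linP_Z lk') scalerBr scalerA ll scale1r /T.
    by rewrite addrA subrK.
  rewrite (le_trans (nrmD _ _)) // nrmZ lk1 mul1r h3 mulrDl mul1r lerD2r.
  exact: hM.
have h5 := hL (T x); set Y := nrm (N k x - l k *: x) in h1 h4.
have h6 : s ^+ 2 * nrm x <= nrm (T (T x)) + nrm (T (T x) - (s ^+ 2)%:C *: x).
  have -> : s ^+ 2 * nrm x = nrm ((s ^+ 2)%:C *: x).
    by rewrite nrmZ nrm_real ger0_norm // sqr_ge0.
  rewrite -[X in nrm X <= _](subrK (T (T x))) addrC (le_trans (nrmD _ _)) //.
  by rewrite lerD2l nrmB.
have h7 := ler_wpM2l (ltW L0) h4.
have h8 : nrm (T (T x) - (s ^+ 2)%:C *: x) <= e * nrm x by lra.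
have h9 : Y <= e * nrm x by have := nrm_ge0 (T (T x) - (s ^+ 2)%:C *: x); lra.
have h10 : L * ((M + 1) * Y) <= L * ((M + 1) * (e * nrm x)).
  by rewrite !ler_wpM2l // ?ltW // addr_gt0.
have h11 : e * nrm x + L * ((M + 1) * (e * nrm x)) = s ^+ 2 * nrm x / 2.
  by rewrite /e; field; rewrite gt_eqF.
have : 0 < s ^+ 2 * nrm x by rewrite mulr_gt0 // exprn_gt0.
lra.
Qed.

End JointSpectrum.

(** * Closed subspaces as Hilbert spaces *)

Section ClosedSubspace.
Context {R : realType} {K : hilbertType R}.
Local Notation C := R[i].

Record closed_subspace := ClosedSubspace {
  subspace_pred : {pred K};
  subspace_submod : submod_closed subspace_pred;
  subspace_closed : forall x, (forall e : R, 0 < e ->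
    exists2 y, y \in subspace_pred & nrm (x - y) <= e) -> x \in subspace_pred }.

Variable P : closed_subspace.

Definition subspace_mem : {pred K} := subspace_pred P.

HB.instance Definition _ :=
  GRing.isSubmodClosed.Build C K subspace_mem (subspace_submod P).

Record subspace_type := SubspaceElt {
  subspace_val :> K; _ : subspace_val \in subspace_mem }.

HB.instance Definition _ := [isSub for subspace_val].
HB.instance Definition _ := [Choice of subspace_type by <:].
HB.instance Definition _ := [SubChoice_isSubLmodule of subspace_type by <:].

Let sval_norm (x : subspace_type) : C := `|val x|.

Let sval_normD x y : sval_norm (x + y) <= sval_norm x + sval_norm y.
Proof. exact: ler_normD. Qed.

Let sval_normZ (a : C) x : sval_norm (a *: x) = `|a| * sval_norm x.
Proof. exact: normrZ. Qed.

Let sval_norm_eq0 x : sval_norm x = 0 -> x = 0.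
Proof. by move=> /normr0_eq0 h; apply: val_inj. Qed.

HB.instance Definition _ := Lmodule_isNormed.Build C subspace_type
  sval_normD sval_normZ sval_norm_eq0.

Let subspace_complete (F : set_system subspace_type) :
  ProperFilter F -> cauchy F -> cvg F.
Proof.
move=> FF /cauchyP cF.
have [l hl] : exists l : K, val @ F --> l.
  apply/cvg_ex; apply: cauchy_cvg; apply: cauchy_exP => e /cF[x hx].
  exists (val x); rewrite /fmap /=; apply: filterS hx => y.
  by rewrite -!ball_normE.
have lP : l \in subspace_mem.
  apply: (subspace_closed (c := P)) => e e0.
  have e0' : 0 < e%:C by rewrite ltcR.
  have /cvgrPdist_lt/(_ _ e0') /filter_ex[x hx] := hl.
  by exists (val x); [exact: valP|rewrite -lecR -nrmE ltW].
apply/cvg_ex; exists (SubspaceElt lP); apply/cvgrPdist_lt => e e0.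
by have /cvgrPdist_lt/(_ _ e0) := hl; apply: filterS.
Qed.

HB.instance Definition _ := Uniform_isComplete.Build subspace_type subspace_complete.

Definition subspace_inner (x y : subspace_type) : C := inner (val x) (val y).

Let subspace_inner_bilinear : bilinear_for
  (GRing.Scale.Law.clone _ _ ( *%R ) _) (GRing.Scale.Law.clone _ _ (Num.conj \; *%R ) _)
  subspace_inner.
Proof.
split=> [u a x y|u a x y]; rewrite /subspace_inner.
  exact: linearPl.
exact: linearPr.
Qed.

HB.instance Definition _ := bilinear_isBilinear.Build C subspace_type subspace_type C
  _ _ subspace_inner subspace_inner_bilinear.

Let subspace_inner_herm (x y : subspace_type) :
  subspace_inner x y = (-1) ^+ false * Num.conj (subspace_inner y x).
Proof. exact: hermC. Qed.

HB.instance Definition _ := isHermitianSesquilinear.Build C subspace_type false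
  Num.conj subspace_inner subspace_inner_herm.

Let subspace_inner_gt0 (u : subspace_type) : u != 0 -> 0 < subspace_inner u u.
Proof. by move=> u0; apply: neq0_dnorm_gt0. Qed.

HB.instance Definition _ := isDotProduct.Build C subspace_type subspace_inner
  subspace_inner_gt0.

Let subspace_sqr_norm (x : subspace_type) :
  `|x| ^+ 2 = (subspace_inner : {dot subspace_type for @Num.conj C}) x x.
Proof. exact: sqr_norm_inner. Qed.

HB.instance Definition _ := CompleteNormedModule_isHilbert.Build R subspace_type
  subspace_sqr_norm.

End ClosedSubspace.

(** Hides the subtype construction behind an isometric inclusion [j] with prescribed range. *)
Lemma closed_subspace_hilbert (R : realType) (K : hilbertType R) (P : set K) :
  P 0 -> (forall (a : R[i]) x y, P x -> P y -> P (a *: x + y)) ->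
  (forall x, (forall e : R, 0 < e -> exists2 y, P y & nrm (x - y) <= e) -> P x) ->
  exists (K0 : hilbertType R) (j : {linear K0 -> K}),
    (forall x y, inner (j x) (j y) = inner x y) /\
    (forall x, P x <-> exists z, j z = x).
Proof.
move=> P0 PL Pc; pose p : {pred K} := [pred x | `[< P x >]].
have p_submod : submod_closed p.
  split=> [|a x y /asboolP Px /asboolP Py]; apply/asboolP => //.
  exact: PL.
have p_closed x : (forall e : R, 0 < e -> exists2 y, y \in p & nrm (x - y) <= e) ->
    x \in p.
  move=> h; apply/asboolP/Pc => e /h[y /asboolP Py hy]; by exists y.
pose S := ClosedSubspace p_submod p_closed.
exists (subspace_type S : hilbertType R), (val : {linear subspace_type S -> K}).
split=> // x; split=> [Px|[z <-]].
  have xp : x \in subspace_mem S by apply/asboolP.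
  by exists (SubspaceElt xp).
by have /asboolP := valP z.
Qed.

(** * Extension of commuting isometries *)

Section ClosedGraph.
Context {R : realType} {K : hilbertType R}.
Local Notation C := R[i].
Context (G : K -> K -> Prop).
Hypotheses (G0 : G 0 0)
  (G_lin : forall (a : C) x y x' y', G x y -> G x' y' -> G (a *: x + x') (a *: y + y'))
  (G_nrm : forall x y, G x y -> nrm x = nrm y).

(** Treating an isometry as a relation postpones the question whether it is well defined: linearity
    and preservation of norms make the closed relation single-valued. *)
Definition graph_closure x y := forall e : R, 0 < e ->
  exists a b, [/\ G a b, nrm (x - a) <= e & nrm (y - b) <= e].

Lemma graph_closure_sub x y : G x y -> graph_closure x y.
Proof. by move=> h e e0; exists x, y; rewrite !subrr nrm0 (ltW e0). Qed.

Lemma graph_closure_closed x y : (forall e : R, 0 < e ->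
  exists a b, [/\ graph_closure a b, nrm (x - a) <= e & nrm (y - b) <= e]) ->
  graph_closure x y.
Proof.
move=> h e e0; have e2 : 0 < e / 2 by rewrite divr_gt0.
have [a [b [/(_ _ e2)[a' [b' [g ha hb]]] xa yb]]] := h _ e2.
exists a', b'; split=> //; last first.
  rewrite -(subrKA b); have := nrmD (y - b) (b - b'); lra.
rewrite -(subrKA a); have := nrmD (x - a) (a - a'); lra.
Qed.

Lemma graph_closure_lin (a : C) x y x' y' : graph_closure x y -> graph_closure x' y' ->
  graph_closure (a *: x + x') (a *: y + y').
Proof.
move=> h h' e e0.
have c0 : 0 < nrm a + 1 by rewrite ltr_wpDl ?nrm_ge0.
have e2 : 0 < e / 2 by rewrite divr_gt0.
have ea : 0 < e / 2 / (nrm a + 1) by rewrite divr_gt0.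
have [u [v [g1 xu yv]]] := h _ ea; have [u' [v' [g2 xu' yv']]] := h' _ e2.
exists (a *: u + u'), (a *: v + v'); split; first exact: G_lin.
  rewrite opprD addrACA -scalerBr (le_trans (nrmD _ _)) // nrmZ.
  have : nrm a * nrm (x - u) <= (nrm a + 1) * (e / 2 / (nrm a + 1)).
    by rewrite ler_pM ?nrm_ge0 ?lerDl.
  by rewrite [(nrm a + 1) * _]mulrC divfK ?gt_eqF //; lra.
rewrite opprD addrACA -scalerBr (le_trans (nrmD _ _)) // nrmZ.
have : nrm a * nrm (y - v) <= (nrm a + 1) * (e / 2 / (nrm a + 1)).
  by rewrite ler_pM ?nrm_ge0 ?lerDl.
by rewrite [(nrm a + 1) * _]mulrC divfK ?gt_eqF //; lra.
Qed.

Lemma graph_closure_nrm x y : graph_closure x y -> nrm x = nrm y.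
Proof.
move=> h; apply/le_anti/andP; split; rewrite -subr_le0;
  apply: (@ge0_le_eps _ _ 2) => e e0;
  have [a [b [g xa yb]]] := h _ e0; have gn := G_nrm g.
  have := nrmD (x - a) a; have := nrmD (b - y) y; rewrite !subrK nrmB; lra.
have := nrmD (a - x) x; have := nrmD (y - b) b; rewrite !subrK (nrmB a); lra.
Qed.

Lemma graph_closure_fun x y y' : graph_closure x y -> graph_closure x y' -> y = y'.
Proof.
move=> h h'; have := graph_closure_lin (-1) h h'; rewrite !scaleN1r addNr.
by move/graph_closure_nrm; rewrite nrm0 addrC => /esym/nrm_eq0/eqP; rewrite subr_eq0 => /eqP.
Qed.

(** The domain of the closed relation is closed: images of a fast approximating sequence are Cauchy,
    since differences keep their norm. *)
Lemma graph_closure_total x : (forall e : R, 0 < e ->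
  exists a b, graph_closure a b /\ nrm (x - a) <= e) -> exists y, graph_closure x y.
Proof.
move=> h.
have /choice[ab hab] : forall k : nat, exists ab : K * K,
    graph_closure ab.1 ab.2 /\ nrm (x - ab.1) <= 2^-1 ^+ k.
  move=> k; have [|a [b hab]] := h (2^-1 ^+ k); last by exists (a, b).
  by rewrite exprn_gt0 // invr_gt0.
have [|||y hy] := @geometric_limit R K (fun k => (ab k).2) 2 2^-1.
- by rewrite invr_ge0.
- by rewrite invf_lt1 // ltr1n.
- move=> k; have [g1 h1] := hab k; have [g2 h2] := hab k.+1.
  have := graph_closure_nrm (graph_closure_lin (-1) g1 g2).
  rewrite !scaleN1r !(addrC (- _)) => <-.
  rewrite -(subrKA x) (le_trans (nrmD _ _)) // nrmB.
  rewrite exprS in h2.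
  have : 0 <= 2^-1 ^+ k :> R by rewrite exprn_ge0 // invr_ge0.
  lra.
exists y; apply: graph_closure_closed => e e0.
have qc : (fun k => 2^-1 ^+ k) @ \oo --> (0 : R).
  by apply: cvg_expr; rewrite ger0_norm ?invr_ge0 // invf_lt1 // ltr1n.
have e8 : 0 < e / 4 by rewrite divr_gt0.
have /cvgrPdist_lt/(_ _ e8)[k _ hk] := qc.
have := hk k (leqnn _); rewrite sub0r normrN ger0_norm ?exprn_ge0 ?invr_ge0 // => qk.
have [g hx] := hab k; exists (ab k).1, (ab k).2; split=> //; first lra.
apply: le_trans (hy k) _; have -> : 1 - 2^-1 = 2^-1 :> R by lra.
rewrite invrK; lra.
Qed.

Lemma graph_closure_map (T : K -> K) x y : bounded_operator T ->
  (forall a b, G a b -> G (T a) (T b)) ->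
  graph_closure x y -> graph_closure (T x) (T y).
Proof.
move=> bT hT h e e0; have [M M0 hM] := bounded_nrm bT; have lT := bounded_lin bT.
have eM : 0 < e / M by rewrite divr_gt0.
have [a [b [g xa yb]]] := h _ eM; exists (T a), (T b).
have s z : nrm z <= e / M -> M * nrm z <= e by rewrite ler_pdivlMr // mulrC.
split; [exact: hT| |]; rewrite -(linP_B lT) (le_trans (hM _)) //; exact: s.
Qed.

Lemma graph_closure_next x y : (forall a b, G a b -> exists c, G b c) ->
  graph_closure x y -> exists z, graph_closure y z.
Proof.
move=> hG h; apply: graph_closure_total => e /h[a [b [g _ yb]]].
by have [c gc] := hG _ _ g; exists b, c; split=> //; exact: graph_closure_sub.
Qed.

End ClosedGraph.

Section IsometricExtension.
Context {R : realType} {H K : hilbertType R} (J : {linear H -> K}) (n : nat).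
Local Notation C := R[i].
Context (M M' : 'I_n -> K -> K) (W : 'I_n -> H -> H) (V : H -> H).
Hypotheses (iJ : forall x y, inner (J x) (J y) = inner x y)
  (dM : doubly_commuting M M') (JW : forall i x, J (W i x) = M i (J x))
  (bV : bounded_operator V) (nV : forall x, nrm (V x) = nrm x)
  (cWV : forall i x, W i (V x) = V (W i x)).

(* The graph of the extension of [V] to the reducing subspace generated by [H]. *)
Inductive ext_graph : K -> K -> Prop :=
| ext_base h : ext_graph (J h) (J (V h))
| ext_lin (a : C) x y x' y' : ext_graph x y -> ext_graph x' y' ->
    ext_graph (a *: x + x') (a *: y + y')
| ext_adj i x y : ext_graph x y -> ext_graph (M' i x) (M' i y).

Let lM i : linear (M i).
Proof. by have [np _ _] := dM; have [/bounded_lin] := np i. Qed.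

Let lM' i : linear (M' i).
Proof. by have [np _ _] := dM; have [_ /bounded_lin] := np i. Qed.

Lemma ext_graph0 : ext_graph 0 0.
Proof. by have := ext_base 0; rewrite (linP_0 (bounded_lin bV)) linear0. Qed.

Lemma ext_graph_op i x y : ext_graph x y -> ext_graph (M i x) (M i y).
Proof.
have [_ _ dc] := dM; elim=> [h|a x1 y1 x2 y2 _ h1 _ h2|j x1 y1 _ h1].
- by rewrite -!JW cWV; exact: ext_base.
- by rewrite !lM; exact: ext_lin.
- by have /= <- := dc j i x1; have /= <- := dc j i y1; exact: ext_adj.
Qed.

(** Adjoints in one argument move to the other as operators [M i], which preserve the graph and act
    on H as [W i]. This reduces to two base pairs, where [V] is isometric. *)
Lemma ext_graph_rip x y : ext_graph x y ->
  forall x' y', ext_graph x' y' -> rip x x' = rip y y'.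
Proof.
have [np _ _] := dM; have Z a u v : ext_graph u v -> ext_graph (a *: u) (a *: v).
  by move=> g; have := ext_lin a g ext_graph0; rewrite !addr0.
elim=> [h x' y'|a x1 y1 x2 y2 _ h1 _ h2 x' y' g|i x1 y1 _ h1 x' y' g].
(* The second induction needs [h] general: its cases replace [h] by a scalar multiple or by
   [W i h]. *)
- suff: forall x' y', ext_graph x' y' -> forall h, rip (J h) x' = rip (J (V h)) y'.
    by move=> + g; apply.
  move=> {x y h x' y'} x y; elim=> [h' h|a x1 y1 x2 y2 _ h1 _ h2 h|i x1 y1 _ h1 h].
  + by rewrite /rip !iJ; exact/esym/(isometric_rip nV (bounded_lin bV)).
  + have e (u w1 w2 : K) : rip u (a *: w1 + w2) = rip (a^* *: u) w1 + rip u w2.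
      by rewrite ripDr ripC rip_adjZ ripC.
    by rewrite !e h2 -!linearZ /= h1 (linP_Z (bounded_lin bV)).
  + have [_ _ ai _] := np i.
    by rewrite -!ai -!JW h1 cWV.
- by rewrite !ripDl !rip_adjZ (h2 _ _ g) (h1 _ _ (Z _ _ _ g)).
- by have [_ _ /adj_sym ai _] := np i; rewrite !ai; apply/h1/ext_graph_op.
Qed.

Lemma ext_graph_nrm x y : ext_graph x y -> nrm x = nrm y.
Proof.
move=> g; apply/eqP; rewrite -(@eqrXn2 _ 2) ?nrm_ge0 // !sqr_nrm; apply/eqP.
exact: ext_graph_rip.
Qed.

Lemma ext_graph_next x y : ext_graph x y -> exists z, ext_graph y z.
Proof.
elim=> [h|a x1 y1 x2 y2 _ [z1 g1] _ [z2 g2]|i x1 y1 _ [z1 g1]].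
- by exists (J (V (V h))); exact: ext_base.
- by exists (a *: z1 + z2); exact: ext_lin.
- by exists (M' i z1); exact: ext_adj.
Qed.

(** [K0] is the domain of the closed graph, which [M] and [M'] leave invariant; the graph itself
    becomes [U]. *)
Lemma isometric_extension (p : nat) (k : 'I_n) :
  (forall x, iter p V x = W k x) ->
  exists (K0 : hilbertType R) (j : {linear K0 -> K}) (J0 : {linear H -> K0})
    (M0 M0' : 'I_n -> K0 -> K0) (U : K0 -> K0),
  [/\ (forall x y, inner (j x) (j y) = inner x y) /\ (forall h, j (J0 h) = J h),
      doubly_commuting M0 M0' /\ (forall i x, j (M0 i x) = M i (j x)),
      linear U /\ (forall x, nrm (U x) = nrm x),
      (forall i x, U (M0 i x) = M0 i (U x)) /\ (forall i x, U (M0' i x) = M0' i (U x))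
    & (forall h, J0 (V h) = U (J0 h)) /\ (forall x, iter p U x = M0 k x)].
Proof.
move=> VW; pose Gc := graph_closure ext_graph.
have [np cM dc] := dM; have lV := bounded_lin bV.
have bM i : bounded_operator (M i) by have [] := np i.
have bM' i : bounded_operator (M' i) by have [] := np i.
have Gc_lin : forall (a : C) x y x' y', Gc x y -> Gc x' y' -> Gc (a *: x + x') (a *: y + y').
  exact: graph_closure_lin ext_lin.
have Gc_nrm x y : Gc x y -> nrm x = nrm y := graph_closure_nrm ext_graph_nrm (x:=x) (y:=y).
have Gc_fun x y y' : Gc x y -> Gc x y' -> y = y'.
  by move=> h1 h2; exact: (graph_closure_fun ext_lin ext_graph_nrm h1 h2).
have [||x h|K0 [j [ij jP]]] := @closed_subspace_hilbert R K [set x | exists y, Gc x y].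
- by exists 0; apply: graph_closure_sub; exact: ext_graph0.
- by move=> a x y [x' gx] [y' gy]; exists (a *: x' + y'); exact: Gc_lin.
- apply: (graph_closure_total ext_lin ext_graph_nrm) => e /h[y [y' gy] xy].
  by exists y, y'.
have nj x : nrm (j x) = nrm x.
  by apply/eqP; rewrite -(@eqrXn2 _ 2) ?nrm_ge0 // !sqr_nrm /rip ij.
have rj x y : rip (j x) (j y) = rip x y by rewrite /rip ij.
have j_inj : injective j.
  move=> x y e; apply/eqP; rewrite -subr_eq0; apply/eqP/nrm_eq0.
  by rewrite -nj linearB e subrr nrm0.
have lift (T : K -> K) : bounded_operator T ->
    (forall x y, ext_graph x y -> ext_graph (T x) (T y)) ->
    exists T0 : K0 -> K0, forall x, j (T0 x) = T (j x).
  move=> bT hT; suff /choice[T0 hT0] : forall x, exists y, j y = T (j x) by exists T0.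
  move=> x; apply/jP; have [y gy] : exists y, Gc (j x) y by apply/jP; exists x.
  by exists (T y); exact: graph_closure_map.
have /choice[M0 hM0] : forall i, exists T0 : K0 -> K0, forall x, j (T0 x) = M i (j x).
  by move=> i; apply: lift => // x y; exact: ext_graph_op.
have /choice[M0' hM0'] : forall i, exists T0 : K0 -> K0, forall x, j (T0 x) = M' i (j x).
  by move=> i; apply: lift => // x y; exact: ext_adj.
have bound0 (T : K -> K) (T0 : K0 -> K0) : bounded_operator T ->
    (forall x, j (T0 x) = T (j x)) -> bounded_operator T0.
  move=> bT hT; have [B B0 hB] := bounded_nrm bT; apply: (@nrm_bounded _ _ _ B).
    move=> a x y; apply: j_inj.
    by rewrite !(hT, linearP) (bounded_lin bT).
  by move=> x; rewrite -!nj hT.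
have dM0 : doubly_commuting M0 M0'.
  split=> [i|i i' x|i i' x].
  - have [_ _ a c] := np i; split; [exact: bound0 (hM0 i)|exact: bound0 (hM0' i)| |].
      by move=> x y; rewrite -!rj hM0 hM0' a.
    by move=> x /=; apply: j_inj; rewrite !(hM0, hM0'); exact: c.
  - by apply: j_inj => /=; rewrite !hM0; exact: cM.
  - by apply: j_inj => /=; rewrite !(hM0, hM0'); exact: dc.
have /choice[J0 hJ0] : forall h, exists z, j z = J h.
  move=> h; apply/jP; exists (J (V h)); apply: graph_closure_sub; exact: ext_base.
have lJ0 : linear J0.
  by move=> a x y; apply: j_inj; rewrite !(hJ0, linearP).
(* The range of the graph lies in its domain, so [U] maps [K0] to itself. *)
have /choice[U hU] : forall x, exists z, Gc (j x) (j z).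
  move=> x; have [y gy] : exists y, Gc (j x) y by apply/jP; exists x.
  have /jP[z jz] : exists z, Gc y z.
    exact: (graph_closure_next ext_lin ext_graph_nrm ext_graph_next gy).
  by exists z; rewrite jz.
have U_eq x z : Gc (j x) (j z) -> U x = z.
  by move=> g; apply: j_inj; exact: Gc_fun (hU x) g.
have lU : linear U.
  by move=> a x y; apply: U_eq; rewrite !linearP; exact: Gc_lin (hU x) (hU y).
have nU x : nrm (U x) = nrm x by rewrite -nj -(Gc_nrm _ _ (hU x)) nj.
have UM i x : U (M0 i x) = M0 i (U x).
  apply: U_eq; rewrite !hM0; apply: graph_closure_map (hU x) => // a b.
  exact: ext_graph_op.
have UM' i x : U (M0' i x) = M0' i (U x).
  apply: U_eq; rewrite !hM0'; apply: graph_closure_map (hU x) => // a b.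
  exact: ext_adj.
have UJ h : J0 (V h) = U (J0 h).
  by apply/esym/U_eq; rewrite !hJ0; apply: graph_closure_sub; exact: ext_base.
have lUp : linear (iter p U).
  elim: (p) => [//|q ih] a x y; by rewrite iterS ih lU.
have nUp x : nrm (iter p U x) = nrm x by elim: (p) => //= q; rewrite nU.
(* The relation holds on H by the hypothesis on [V] and spreads over the generated space because
   both sides are linear and commute with every [M0' i]. *)
have Up_graph x y : ext_graph x y -> forall z, j z = x -> iter p U z = M0 k z.
  elim=> [h|a x1 y1 x2 y2 g1 h1 g2 h2|i x1 y1 g1 h1] z jz.
  - have -> : z = J0 h by apply: j_inj; rewrite hJ0.
    have -> : iter p U (J0 h) = J0 (iter p V h).
      by elim: (p) => //= q ->; rewrite UJ.
    by apply: j_inj; rewrite hM0 !hJ0 VW JW.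
  - have [z1 jz1] : exists z1, j z1 = x1.
      by apply/jP; exists y1; exact: graph_closure_sub.
    have [z2 jz2] : exists z2, j z2 = x2.
      by apply/jP; exists y2; exact: graph_closure_sub.
    have -> : z = a *: z1 + z2 by apply: j_inj; rewrite linearP jz jz1 jz2.
    have [/(_ k)[/bounded_lin lMk _ _ _] _ _] := dM0.
    by rewrite lUp (h1 _ jz1) (h2 _ jz2) lMk.
  - have [z1 jz1] : exists z1, j z1 = x1.
      by apply/jP; exists y1; exact: graph_closure_sub.
    have -> : z = M0' i z1 by apply: j_inj; rewrite hM0' jz jz1.
    have [_ _ dc0] := dM0; have /= <- := dc0 i k z1; rewrite -(h1 _ jz1).
    by elim: (p) => //= q ->; rewrite UM'.
have Up x : iter p U x = M0 k x.
  have [/(_ k)[bMk _ _ _] _ _] := dM0; have lMk := bounded_lin bMk.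
  have [B B0 hB] := bounded_nrm bMk.
  apply/eqP; rewrite -subr_eq0; apply/eqP/nrm_eq0/le_anti; rewrite nrm_ge0 andbT.
  (* The domain of the graph before closure is dense in [K0], and both sides are continuous. *)
  apply: (@ge0_le_eps _ _ (1 + B)) => e e0.
  have [a [b [g xa _]]] := hU x _ e0.
  have [z jz] : exists z, j z = a by apply/jP; exists b; exact: graph_closure_sub.
  have xz : nrm (x - z) <= e by rewrite -nj linearB jz.
  rewrite -(subrK z x) (linP_D lUp) (linP_D lMk) (Up_graph _ _ g _ jz).
  rewrite opprD addrACA subrr addr0 (le_trans (nrmD _ _)) // nrmN nUp.
  have := hB (x - z); have := ler_wpM2l (ltW B0) xz; lra.
pose J0l : {linear H -> K0} := HB.pack J0 (GRing.isLinear.Build _ _ _ _ _ lJ0).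
by exists K0, j, J0l, M0, M0', U.
Qed.

End IsometricExtension.

(** * Distinguished boundaries *)

Section Torus.
Context {R : realType}.
Local Notation C := R[i].

Lemma elem_sym_full n (z : 'I_n -> C) : elem_sym n z = \prod_j z j.
Proof.
rewrite /elem_sym (big_pred1 [set: 'I_n]%SET) => [|A].
  by apply: eq_bigl => i; rewrite inE.
by rewrite [RHS]eqEcard finset.subsetT /= cardsT card_ord eqn_leq -[X in (_ <= X)%N]card_ord max_card.
Qed.

Lemma torus_nrm n (z : 'I_n -> C) : torus z <-> forall i, nrm (z i) = 1.
Proof.
split=> h i; first by rewrite /nrm h.
by rewrite nrmE h.
Qed.

Lemma nrm_prod (I : Type) (s : seq I) (F : I -> C) :
  (forall i, nrm (F i) = 1) -> nrm (\prod_(i <- s) F i) = 1.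
Proof.
move=> h; elim/big_rec: _ => [|i x _ hx]; first exact: nrm1.
by rewrite nrmM h hx mulr1.
Qed.

Lemma bGamma_last n (l : 'I_n.+1 -> C) : bGamma l -> nrm (l ord_max) = 1.
Proof.
by move=> [z /torus_nrm hz <-]; rewrite /sym_map elem_sym_full nrm_prod.
Qed.

Lemma bTheta_last m p n (l : 'I_n.+1 -> C) : bTheta m p l -> nrm (l ord_max) = 1.
Proof.
move=> [z /torus_nrm hz <-].
by rewrite /theta_map eqxx nrmX nrm_prod // expr1n.
Qed.

Lemma bTheta_bGamma m p n (l : 'I_n.+1 -> C) : (p %| m)%N -> bTheta m p l ->
  bGamma (fun i => if i == ord_max then l i ^+ p else l i).
Proof.
move=> pm [z /torus_nrm hz <-]; exists (fun j => z j ^+ m).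
  by apply/torus_nrm => i; rewrite nrmX hz expr1n.
apply/funext => i; rewrite /sym_map /theta_map; case: eqP => [->|//].
by rewrite elem_sym_full prodrXl -exprM divnK.
Qed.

(** Take m-th roots y_j of the w_j, with product Y. Then l_n and Y^q differ by a factor z with z^p =
    1. Multiplying one y_j by e with e^q = z repairs the last entry, and e^m = 1 leaves the others
    unchanged. *)
Lemma bGamma_bTheta m p n (l : 'I_n.+1 -> C) : (0 < m)%N -> (0 < p)%N -> (p %| m)%N ->
  bGamma (fun i => if i == ord_max then l i ^+ p else l i) -> bTheta m p l.
Proof.
move=> m0 p0 pm [w /torus_nrm hw lw]; set q := (m %/ p)%N.
have qp : (q * p)%N = m by rewrite divnK.
have q0 : (0 < q)%N by rewrite divn_gt0 // dvdn_leq.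
have nroot a k (x : C) : nrm a = 1 -> (0 < k)%N -> x ^+ k = a -> nrm x = 1.
  move=> na k0 xa; apply/eqP; rewrite -(@pexpr_eq1 _ _ k) ?nrm_ge0 //.
  by rewrite -nrmX xa na.
pose y j := m.-root (w j); have ym j : y j ^+ m = w j by rewrite rootCK.
have ny j : nrm (y j) = 1 := nroot _ _ _ (hw j) m0 (ym j).
pose Y := \prod_j y j; have nY : nrm Y = 1 by rewrite nrm_prod.
have Y0 : Y != 0 by apply/eqP => e; move: nY; rewrite e nrm0 => /esym/eqP; rewrite oner_eq0.
have lp : l ord_max ^+ p = Y ^+ m.
  have := congr1 (fun f => f ord_max) lw; rewrite /sym_map eqxx elem_sym_full => <-.
  by rewrite -prodrXl; apply: eq_bigr => j _; rewrite ym.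
pose z := l ord_max / Y ^+ q.
have zp : z ^+ p = 1.
  by rewrite expr_div_n lp -exprM qp divff // expf_neq0.
pose e := q.-root z; have eq : e ^+ q = z by rewrite rootCK.
have em : e ^+ m = 1 by rewrite -qp exprM eq.
have ne : nrm e = 1 := nroot _ _ _ nrm1 m0 em.
exists (fun j => if j == ord_max then e * y j else y j).
  by apply/torus_nrm => j; case: ifP => _; rewrite ?nrmM ny ?ne ?mulr1.
apply/funext => i; rewrite /theta_map; case: eqP => [->|/eqP im].
  rewrite (bigD1 ord_max) //= eqxx (eq_bigr y) => [|j /negbTE ->//].
  have yY : y ord_max * \prod_(j | j != ord_max) y j = Y by rewrite /Y [RHS](bigD1 ord_max) //=.
  rewrite -mulrA yY -/q exprMn eq.
  by rewrite /z divfK // expf_neq0.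
have := congr1 (fun f => f i) lw; rewrite /sym_map (negbTE im) => <-.
apply: eq_bigr => A _; apply: eq_bigr => j _.
by case: ifP => _; rewrite ?exprMn ?em ?mul1r ym.
Qed.

End Torus.

(** * Powers of the last operator *)

Section PowerOfLast.
Context {R : realType}.
Local Notation C := R[i].

Lemma isometry_nrm (H K : hilbertType R) (J : {linear H -> K}) :
  (forall x y, inner (J x) (J y) = inner x y) -> forall x, nrm (J x) = nrm x.
Proof.
move=> iJ x; apply/eqP; rewrite -(@eqrXn2 _ 2) ?nrm_ge0 // !sqr_nrm.
by rewrite /rip iJ.
Qed.

Lemma approx_null_map (H K : hilbertType R) (J : H -> K) (phi : H -> R) (psi : K -> R) (B : R) :
  (forall x, nrm (J x) = nrm x) -> 0 < B -> (forall x, psi (J x) <= B * phi x) ->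
  approx_null phi -> approx_null psi.
Proof.
move=> nJ B0 h an e e0; have [|x x0 hx] := an (e / B); first by rewrite divr_gt0.
exists (J x).
  by apply/eqP => Jx; have := nrm_gt0 x0; rewrite -nJ Jx nrm0 ltxx.
rewrite nJ (le_trans (h x)) // (le_trans (ler_wpM2l (ltW B0) hx)) //.
by rewrite mulrA mulrCA divff ?gt_eqF // mulr1.
Qed.

Lemma approx_null_scalar (H : hilbertType R) (phi : H -> R) (c : C) (B : R) :
  (forall x, nrm c * nrm x <= B * phi x) -> 0 < B -> approx_null phi -> c = 0.
Proof.
move=> h B0 an; apply: nrm_eq0; apply/le_anti; rewrite nrm_ge0 andbT.
apply: (@ge0_le_eps _ _ B) => e e0; have [x x0 hx] := an e e0.
rewrite -(ler_pM2r (nrm_gt0 x0)) (le_trans (h x)) // -mulrA.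
by rewrite ler_wpM2l // ltW.
Qed.

Lemma iter_defect (H : hilbertType R) (U : H -> H) (p : nat) (l : C) :
  bounded_operator U -> exists2 B : R, 0 < B &
    forall x, nrm (iter p U x - l ^+ p *: x) <= B * nrm (U x - l *: x).
Proof.
move=> bU; have lU := bounded_lin bU; have [L L0 hL] := bounded_nrm bU.
elim: p => [|p [B B0 hB]].
  by exists 1 => // x; rewrite expr0 scale1r subrr nrm0 mul1r nrm_ge0.
exists (L * B + nrm l ^+ p); first by rewrite ltr_wpDr ?exprn_ge0 ?nrm_ge0 // mulr_gt0.
move=> x; have -> : iter p.+1 U x - l ^+ p.+1 *: x =
    U (iter p U x - l ^+ p *: x) + l ^+ p *: (U x - l *: x).
  rewrite iterS (linP_B lU) (linP_Z lU) scalerBr scalerA exprSr.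
  by rewrite addrA subrK.
rewrite (le_trans (nrmD _ _)) // nrmZ nrmX mulrDl lerD2r.
by rewrite (le_trans (hL _)) // -mulrA ler_wpM2l // ltW.
Qed.

Lemma iter_commute (T : Type) (f g : T -> T) k x :
  (forall y, f (g y) = g (f y)) -> iter k f (g x) = g (iter k f x).
Proof. by move=> h; elim: k => //= k ->. Qed.

Lemma normal_pair_iter (H : hilbertType R) (T S : H -> H) k :
  normal_pair T S -> normal_pair (iter k T) (iter k S).
Proof.
case=> bT bS a c; split; [exact: bounded_iter|exact: bounded_iter|exact: adj_iter|].
have c1 y : T (iter k S y) = iter k S (T y).
  by rewrite (iter_commute (f := S) (g := T)) // => z; exact/esym/c.
by move=> x /=; rewrite (iter_commute (f := T) (g := iter k S)).
Qed.

Definition last_power n (T : Type) (p : nat) (N : 'I_n.+1 -> T -> T) i :=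
  if i == ord_max then iter p (N i) else N i.

Lemma last_power_commuting (H : hilbertType R) n p (N : 'I_n.+1 -> H -> H) :
  commuting_tuple N -> commuting_tuple (last_power p N).
Proof.
move=> c i j x; rewrite /last_power /=.
have c1 i' j' y : N i' (iter p (N j') y) = iter p (N j') (N i' y).
  by rewrite (iter_commute (f := N j') (g := N i')) // => z; exact: c.
case: eqP => _; case: eqP => _; last exact: c.
- by rewrite (iter_commute (f := N i) (g := iter p (N j))).
- by rewrite c1.
- by rewrite c1.
Qed.

Lemma doubly_commuting_last_power (H : hilbertType R) n p (N N' : 'I_n.+1 -> H -> H) :
  doubly_commuting N N' -> doubly_commuting (last_power p N) (last_power p N').
Proof.
move=> [np c dc]; split; first 1 last.
- exact: last_power_commuting.
- move=> i j x; rewrite /last_power /=.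
  have c1 y : N' i (iter p (N j) y) = iter p (N j) (N' i y).
    by rewrite (iter_commute (f := N j) (g := N' i)) // => z; exact/esym/dc.
  case: eqP => _; case: eqP => _; last exact: dc.
  + by rewrite (iter_commute (f := N' i) (g := iter p (N j))).
  + by rewrite (iter_commute (f := N' i) (g := N j)) // => z; exact: dc.
  + by rewrite c1.
- by move=> i; rewrite /last_power; case: eqP => _ //; exact: normal_pair_iter.
Qed.

Lemma doubly_commuting_unitary (H : hilbertType R) n X (N N' : 'I_n -> H -> H) :
  doubly_commuting N N' -> (joint_spectrum N `<=` X) -> unitary_tuple X N.
Proof.
move=> [np c _] sp; split=> // i; have [bN bN' a cN] := np i; split=> //.
by exists (N' i) => //; apply: adj_is_adjoint => //; exact: bounded_lin.
Qed.

(** Approximate eigenvectors of the powered tuple are refined to ones of [N], with eigenvalues mu.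
    On these vectors both l and the powered mu are approximate eigenvalues, hence equal. *)
Lemma spectrum_last_power (H : hilbertType R) n p (N N' : 'I_n.+1 -> H -> H) l :
  doubly_commuting N N' -> joint_spectrum (last_power p N) l ->
  exists2 mu, joint_spectrum N mu &
    l = fun i => if i == ord_max then mu i ^+ p else mu i.
Proof.
move=> dN /(spectrum_approx_null (doubly_commuting_last_power p dN)) an.
have [np c _] := dN; have [npp cp _] := doubly_commuting_last_power p dN.
have bN i : bounded_operator (N i) by have [] := np i.
have bP i : bounded_operator (last_power p N i) by have [] := npp i.
have sp := seminorm_joint_defect l (fun i => bounded_lin (bP i)).
have cNP i j x : last_power p N j (N i x) = N i (last_power p N j x).
  rewrite /last_power; case: eqP => _; last exact: c.
  by rewrite (iter_commute (f := N j) (g := N i)) // => z; exact: c.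
have st i : stable (joint_defect (last_power p N) l) (N i).
  have [B B0 hB] := bounded_nrm (bN i); exists B => x.
  rewrite /joint_defect mulr_sumr; apply: ler_sum => j _.
  by rewrite cNP -(linP_Z (bounded_lin (bN i))) -(linP_B (bounded_lin (bN i))).
have [mu anmu] := approx_eigenvalues sp an np c st.
exists mu.
  apply: (approx_null_spectrum np); apply: approx_null_le anmu => x.
  by rewrite lerDr joint_defect_ge0.
apply/funext => i; apply/eqP; rewrite -subr_eq0; apply/eqP.
have [B B0 hB] : exists2 B : R, 0 < B & forall x, nrm (last_power p N i x -
    (if i == ord_max then mu i ^+ p else mu i) *: x) <= B * nrm (N i x - mu i *: x).
  rewrite /last_power; case: eqP => _; first exact: iter_defect.
  by exists 1 => // x; rewrite mul1r.
apply: (approx_null_scalar (B := 1 + B) _ _ anmu) => [x|]; last by rewrite addr_gt0.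
rewrite -nrmZ scalerBl -(subrKA (last_power p N i x)) (le_trans (nrmD _ _)) // nrmB.
have h1 := joint_defect_ge (last_power p N) l x i.
have h2 := ler_wpM2l (ltW B0) (joint_defect_ge N mu x i).
have h3 := joint_defect_ge0 (last_power p N) l x.
have h4 := joint_defect_ge0 N mu x.
have h5 := hB x; have h6 := mulr_ge0 (ltW B0) h3; lra.
Qed.

End PowerOfLast.

(** * The two implications *)

Lemma theta_isometry_gamma (R : realType) (m p n : nat) (H : hilbertType R)
  (V : 'I_n.+1 -> H -> H) : (p %| m)%N ->
  (forall i, bounded_operator (V i)) -> commuting_tuple V ->
  Theta_isometry m p V ->
  contraction_operator (V ord_max) /\ Gamma_isometry (last_power p V).
Proof.
move=> pm bV cV [_ _ [K [J [N [iJ uN JN]]]]]; have nJ := isometry_nrm iJ.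
have [N' dN] := unitary_doubly_commuting uN; have [_ _ spN] := uN.
split.
  have nN := spectrum_unimodular_isometric dN (fun l hl => bTheta_last (spN l hl)).
  by move=> x; rewrite !nrmE -(nJ (V _ x)) JN nN nJ.
split; first exact: last_power_commuting.
  by move=> i; rewrite /last_power; case: eqP => // _; exact: bounded_iter.
exists K, J, (last_power p N); split=> // [|i x].
  apply: (doubly_commuting_unitary (doubly_commuting_last_power p dN)).
  by move=> l /(spectrum_last_power dN)[mu /spN hmu ->]; exact: bTheta_bGamma hmu.
rewrite /last_power; case: eqP => _ //.
by elim: (p) => //= q ih; rewrite JN ih.
Qed.

Lemma gamma_isometry_theta (R : realType) (m p n : nat) (H : hilbertType R)
  (V : 'I_n.+1 -> H -> H) : (0 < m)%N -> (0 < p)%N -> (p %| m)%N ->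
  (forall i, bounded_operator (V i)) -> commuting_tuple V ->
  contraction_operator (V ord_max) -> Gamma_isometry (last_power p V) ->
  Theta_isometry m p V.
Proof.
move=> m0 p0 pm bV cV ctr [_ _ [K [J [M [iJ uM JM]]]]]; have nJ := isometry_nrm iJ.
have [M' dM] := unitary_doubly_commuting uM; have [_ _ spM] := uM.
have nM := spectrum_unimodular_isometric dM (fun l hl => bGamma_last (spM l hl)).
pose v := V ord_max.
have ctr' x : nrm (v x) <= nrm x by rewrite -lecR -!nrmE.
have ctrk k x : nrm (iter k v x) <= nrm x.
  by elim: k => //= k ih; exact: le_trans (ctr' _) ih.
have nVp x : nrm (iter p v x) = nrm x.
  have e : J (iter p v x) = M ord_max (J x) by rewrite -JM /last_power eqxx.
  by rewrite -nJ e nM nJ.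
(* The contraction hypothesis enters here: |x| = |v^p x| <= |v x| <= |x|. *)
have nV x : nrm (v x) = nrm x.
  apply/le_anti; rewrite ctr' /= -{1}nVp -(prednK p0) iterSr.
  exact: ctrk.
have cVl i x : last_power p V i (v x) = v (last_power p V i x).
  rewrite /last_power; case: eqP => _; last exact: cV.
  by rewrite (iter_commute (f := V i) (g := v)) // => z; exact: cV.
have [|K0 [j [J0 [M0 [M0' [U [[ij jJ0] [dM0 jM0] [lU nU] [UM UM'] [J0V Up]]]]]]]] :=
  @isometric_extension R H K J n.+1 M M' (last_power p V) v iJ dM JM
    (bV ord_max) nV cVl p ord_max.
  by move=> x; rewrite /last_power eqxx.
have nj := isometry_nrm ij.
have [np0 c0 dc0] := dM0; have dc0' := doubly_commuting_adj dM0.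
have bU : bounded_operator U by apply: (@nrm_bounded _ _ _ 1) => // x; rewrite nU mul1r.
(* The inverse of [U]: its p-th power is the unitary M0_n, so U^(p-1) M0_n^* inverts it; as [U] is
   isometric, this is also its adjoint. *)
pose U' x := iter p.-1 U (M0' ord_max x).
have [bMk bMk' ak ck] := np0 ord_max.
have nMk x : nrm (M0 ord_max x) = nrm x by rewrite -nj jM0 nM nj.
have M'M x : M0' ord_max (M0 ord_max x) = x.
  by apply: rip_ext => z; rewrite (adj_sym ak) (isometric_rip nMk (bounded_lin bMk)).
have UU' x : U (U' x) = x.
  by rewrite /U' -iterS prednK // Up; have /= -> := ck x; rewrite M'M.
have U'U x : U' (U x) = x.
  by rewrite /U' -UM' -iterSr prednK // Up; have /= -> := ck x; rewrite M'M.
have npU : normal_pair U U'.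
  split=> //; first exact: bounded_comp (bounded_iter _ bU) bMk'.
    by move=> x y; rewrite -{1}(UU' y) (isometric_rip nU lU).
  by move=> x /=; rewrite UU' U'U.
pose N i := if i == ord_max then U else M0 i.
pose N' i := if i == ord_max then U' else M0' i.
have dN : doubly_commuting N N'.
  split=> [i|i i' x|i i' x]; rewrite /N /N'.
  - by case: eqP.
  - by case: eqP => _; case: eqP => _ /=; rewrite ?UM //; exact: c0.
  - case: eqP => _; case: eqP => _ /=; rewrite ?UU' ?U'U ?UM' //; last exact: dc0.
    rewrite /U'; have /= -> := dc0 ord_max i' x.
    by rewrite (iter_commute (f := U) (g := M0 i')).
split=> //; exists K0, J0, N; split=> [x y||i x].
- by rewrite -ij !jJ0 iJ.
(* The inclusion [j] carries approximate eigenvectors of [N] to ones of [M] for the point with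
   powered last entry, which therefore lies in the joint spectrum of [M]. *)
- apply: (doubly_commuting_unitary dN) => l /(spectrum_approx_null dN) an.
  apply: bGamma_bTheta => //; apply: spM.
  have [np _ _] := dM; apply: (approx_null_spectrum np).
  have [B B0 hB] := iter_defect p (l ord_max) bU.
  apply: (approx_null_map (J := j) (B := 1 + B) nj _ _ an) => [|x].
    by rewrite addr_gt0.
  rewrite /joint_defect mulr_sumr; apply: ler_sum => i _.
  rewrite -jM0 -linearZ -linearB nj /N.
  set d := nrm (_ - l i *: x); have d0 : 0 <= d := nrm_ge0 _.
  have Bd : 0 <= B * d by rewrite mulr_ge0 // ltW.
  rewrite /d; case: eqP => [->|_]; last by rewrite mulrDl mul1r lerDl mulr_ge0 ?nrm_ge0 // ltW.
  rewrite -Up (le_trans (hB x)) // ler_wpM2r ?nrm_ge0 //; lra.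
- rewrite /N; case: eqP => [->|ik]; first exact: J0V.
  have JV : J (V i x) = M i (J x).
    by rewrite -JM /last_power; case: eqP ik.
  apply/eqP; rewrite -subr_eq0; apply/eqP/nrm_eq0.
  by rewrite -nj linearB jM0 !jJ0 JV subrr nrm0.
Qed.

(* The tuple has length n.+1, so that every length at least 1 is covered. *)
Theorem theorem3p6 (R : realType) (m p n : nat)
  (m_gt0 : (0 < m)%N) (p_gt0 : (0 < p)%N) (p_dvd_m : (p %| m)%N)
  (H : hilbertType R) (V : 'I_n.+1 -> H -> H)
  (V_bounded : forall i, bounded_operator (V i))
  (V_commuting : commuting_tuple V) :
  Theta_isometry m p V <->
  (contraction_operator (V ord_max) /\
   Gamma_isometry (fun i => if i == ord_max then iter p (V i) else V i)).
Proof.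
split; first exact: theta_isometry_gamma.
by case; exact: gamma_isometry_theta.
Qed.
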